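(* Let $\mathbb{K}$ be a field and $G$ a simple graph on $[n]$. Let $S=\mathbb{K}[x_1,\ldots,x_n,y_1,\ldots,y_n]$ and $\mathcal{I}_G=(x_ix_j-y_iy_j : \{i,j\}\in E(G))$; for an edge $e=\{i,j\}$ write $\bar g_e=x_ix_j-y_iy_j$. Then: (1) $\beta_{2,3}(S/\mathcal{I}_G)=0$; in particular $\beta_{i,i+1}(S/\mathcal{I}_G)=0$ for all $i\neq 1$. (2) If $G\neq K_2$, then $\beta_{2,4}(S/\mathcal{I}_G)\geq\binom{|E(G)|}{2}$. (3) For an edge $e\in E(G)$, $\beta_{i,i}(S/(\mathcal{I}_{G\setminus e}:\bar g_e))=0$ for all $i>0$. (4) If $G$ is non-bipartite, then $\beta_{3,6}(S/\mathcal{I}_G)\neq 0$. (5) If $G$ is an odd unicyclic graph, then $\beta_{i,j}(S/\mathcal{I}_G)=0$ for all $j>2i$.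
   Context: $\beta_{i,j}=\beta^S_{i,j}$ are graded Betti numbers over $S$ with the standard grading. $G\setminus e$ is the graph on $V(G)$ with edge set $E(G)\setminus\{e\}$, and $\mathcal{I}_{G\setminus e}$ is its parity binomial edge ideal in $S$. A unicyclic graph is a (connected) graph containing exactly one cycle; it is odd unicyclic if that cycle has odd length. *)

(* Defs.v *)
(* Graded Betti numbers of S/I for a
   homogeneous ideal I of S = K[z_0,...,z_{N-1}] (standard grading),
   defined as beta_{i,j}(S/I) = dim_K Tor_i^S(S/I, K)_j, with Tor computed from
   the Koszul resolution of K, i.e. as the degree-j homology of
   (wedge^i K^N) (x) S/I.  All graded pieces are finite-dimensional and are
   handled through coordinates in the monomial basis (mxalgebra row spaces). *)
From HB Require Import structures.
From mathcomp Require Import all_boot all_order all_algebra.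
From mathcomp Require Import mpoly.
From Stdlib Require Import ClassicalEpsilon.

Set Implicit Arguments.
Unset Strict Implicit.
Unset Printing Implicit Defensive.

Import GRing.Theory.
Local Open Scope ring_scope.

Notation Mon N d := {m : 'X_{1..N < d.+1} | mdeg (bmnm m) == d}.
Notation nM N d := #|{: Mon N d}|.

Definition mon (N d : nat) (m : Mon N d) : 'X_{1..N} := bmnm (val m).

Definition polyOf (K : fieldType) (N d : nat) (v : 'rV[K]_(nM N d)) : {mpoly K[N]} :=
  \sum_(i < nM N d) v 0 i *: 'X_[mon (enum_val i)].

(* Id d is (a square matrix whose row space is) the degree-d piece
   I_d = I \cap S_d of the ideal I (given as a set of polynomials). *)
Definition represents (K : fieldType) (N : nat) (I : {mpoly K[N]} -> Prop)
  (Id : forall d, 'M[K]_(nM N d)) : Prop :=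
  forall d (v : 'rV[K]_(nM N d)), (v <= Id d)%MS <-> I (polyOf v).

Notation KB N i d := ({A : {set 'I_N} | #|A| == i} * Mon N d)%type.
Notation nK N i d := #|{: KB N i d}|.

(* Koszul differential wedge^i (x) S_d -> wedge^(i-1) (x) S_(d+1):
   e_A (x) m |-> sum_{k in A} (-1)^#{l in A | l < k} e_(A\k) (x) z_k m *)
Definition Dk (K : fieldType) (N i d : nat) : 'M[K]_(nK N i d, nK N i.-1 d.+1) :=
  \matrix_(p, q)
    let: (A, m) := (enum_val p : KB N i d) in
    let: (B, m') := (enum_val q : KB N i.-1 d.+1) in
    \sum_(k < N | k \in val A)
      (if (val B == val A :\ k) && (mon m' == (mon m + mnm1 k)%MM)
       then (-1) ^+ #|[set l in val A | (l < k)%N]| else 0).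

(* wedge^i (x) I_d inside wedge^i (x) S_d *)
Definition IK (K : fieldType) (N : nat) (Id : forall d, 'M[K]_(nM N d)) (i d : nat)
  : 'M[K]_(nK N i d) :=
  \matrix_(p, q)
    let: (A, r) := (enum_val p : KB N i d) in
    let: (B, m) := (enum_val q : KB N i d) in
    if A == B then Id d (enum_rank r) (enum_rank m) else 0.

(* cycles of the Koszul complex of S/I, lifted to wedge^i (x) S_d *)
Definition cycles (K : fieldType) (N : nat) (Id : forall d, 'M[K]_(nM N d)) (i d : nat)
  : 'M[K]_(nK N i d) :=
  if i == 0%N then 1%:M else kermx (Dk K N i d *m cokermx (IK Id i.-1 d.+1)).

(* boundaries of the Koszul complex of S/I, lifted (plus wedge^i (x) I_d) *)
Definition bounds (K : fieldType) (N : nat) (Id : forall d, 'M[K]_(nM N d)) (i d : nat)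
  : 'M[K]_(nK N i d) :=
  match d return 'M[K]_(nK N i d) with
  | 0 => IK Id i 0
  | d'.+1 => (IK Id i d'.+1 + Dk K N i.+1 d')%MS
  end.

Definition betti_mx (K : fieldType) (N : nat) (Id : forall d, 'M[K]_(nM N d)) (i j : nat)
  : nat :=
  if (i <= j)%N then (\rank (cycles Id i (j - i)) - \rank (bounds Id i (j - i)))%N
  else 0%N.

Lemma inhabited_pieces (K : fieldType) (N : nat) :
  inhabited (forall d, 'M[K]_(nM N d)).
Proof. exact: (inhabits (fun d => 0)). Qed.

Definition betti (K : fieldType) (N : nat) (I : {mpoly K[N]} -> Prop) (i j : nat) : nat :=
  betti_mx (epsilon (inhabited_pieces K N) (represents I)) i j.

Definition ideal_gen (K : fieldType) (N : nat) (gs : seq {mpoly K[N]})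
  : {mpoly K[N]} -> Prop :=
  fun p => exists rs : seq {mpoly K[N]},
    size rs = size gs /\ p = \sum_(k < size gs) rs`_k * gs`_k.

Definition colon (K : fieldType) (N : nat) (I : {mpoly K[N]} -> Prop) (g : {mpoly K[N]})
  : {mpoly K[N]} -> Prop := fun p => I (p * g).

Definition xv (K : fieldType) (n : nat) (i : 'I_n) : {mpoly K[n + n]} := 'X_(lshift n i).
Definition yv (K : fieldType) (n : nat) (i : 'I_n) : {mpoly K[n + n]} := 'X_(rshift n i).

Definition gbar (K : fieldType) (n : nat) (i j : 'I_n) : {mpoly K[n + n]} :=
  xv K i * xv K j - yv K i * yv K j.

Definition edges (n : nat) (G : rel 'I_n) : seq ('I_n * 'I_n) :=
  [seq p : 'I_n * 'I_n <- enum {: 'I_n * 'I_n} | (val p.1 < val p.2)%N && G p.1 p.2].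

Definition nedges (n : nat) (G : rel 'I_n) : nat := size (edges G).

Definition parity_ideal (K : fieldType) (n : nat) (G : rel 'I_n)
  : {mpoly K[n + n]} -> Prop :=
  ideal_gen [seq gbar K p.1 p.2 | p <- edges G].

Definition delete_edge (n : nat) (G : rel 'I_n) (a b : 'I_n) : rel 'I_n :=
  fun u v => G u v && ([set u; v] != [set a; b]).

Definition bipartite (n : nat) (G : rel 'I_n) : Prop :=
  exists c : 'I_n -> bool, forall u v, G u v -> c u != c v.

Definition connected (n : nat) (G : rel 'I_n) : Prop :=
  forall u v, connect G u v.

Definition graph_cycle (n : nat) (G : rel 'I_n) (s : seq 'I_n) : bool :=
  [&& uniq s, (2 < size s)%N & cycle G s].

Definition cycle_edges (n : nat) (s : seq 'I_n) : {set {set 'I_n}} :=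
  [set [set x; next s x] | x in s].

Definition odd_unicyclic (n : nat) (G : rel 'I_n) : Prop :=
  connected G /\
  exists s0, graph_cycle G s0 /\ odd (size s0) /\
    forall s, graph_cycle G s -> cycle_edges s = cycle_edges s0.

Definition is_K2 (n : nat) (G : rel 'I_n) : Prop := n = 2%N /\ nedges G = 1%N.

Definition simple_graph (n : nat) (G : rel 'I_n) : Prop :=
  ssrbool.symmetric G /\ ssrbool.irreflexive G.

(* Main.v *)
(* Koszul homology is computed at the level of chains, functions from subsets of
   the variables to polynomials.  With c_e the evident 1-chain with boundary g_e,
   the linear and quadratic statements follow from the absence of linear syzygies
   among the g_e, which is visible on the monomials x_k y_i y_j.

   Nonvanishing in degree (3,6): a nonbipartite graph contains a triangle or an
   induced path on four vertices, and a linear section sends the corresponding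
   three generators to a regular sequence of quadrics in K[a,b,c]; the product
   c_1 c_2 c_3 is then detected by a functional on the socle.

   Odd unicyclic graphs: the property "beta_{i,j} = 0 for j > 2i" passes from I
   and I : f to I + (f) when f has degree 1 or 2.  Let e = ab be an edge of the
   cycle.  After exchanging x and y on one colour class of the tree T = G - e, the
   ideal of T is its binomial edge ideal J_T and g_e becomes x_a x_b - y_a y_b.
   Removing a simplicial vertex and completing neighbourhoods gives the property
   for J_H with H chordal; both this and J_T : g_e = J_H, with H the completion
   of T at a and b, use Ohtani's decomposition of J_H at a vertex to reduce
   regularity of an element modulo J_H to disjoint unions of cliques, where the
   ideal is toric. *)
Require Import Defs.
From HB Require Import structures.
From mathcomp Require Import all_boot all_order all_algebra.
From mathcomp Require Import mpoly.
From mathcomp Require Import ring zify.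
From Stdlib Require Import Classical ClassicalEpsilon.

Set Implicit Arguments.
Unset Strict Implicit.
Unset Printing Implicit Defensive.
Import GRing.Theory.
Local Open Scope ring_scope.

(** * Exterior chains *)

(** Every argument works over an arbitrary field, so nothing may divide by a degree or by 2. Tor
    classes are handled through explicit lifts to S, without long exact sequences. The bound j > 2i
    survives adding f of degree e <= 2 because the mapping cone brings in Tor_(i-1) of S/(I : f) in
    degree j - e, and j - e > 2(i - 1). The cone itself asks no regularity of f: the work lies in
    recognising I : f as an ideal of the same family. One inclusion comes from explicit identities
    between minors; the other needs f to be regular modulo the candidate. Ohtani's decomposition J_H
    = J_(H_u) ∩ ((x_u, y_u) + J_(H - u)), with H_u the completion at u, reduces this to simpler
    graphs, since an element regular modulo both components is regular modulo their intersection.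
    The second component forces the ideals to carry a set W of vertices whose variables are killed.
    No component has to be shown prime; a domain enters only for disjoint cliques, as the target of
    a monomial map. *)

Section Exterior.
Variables (R : comNzRingType) (N : nat).
Implicit Types (a b : 'I_N -> R) (w : {set 'I_N} -> R) (A B : {set 'I_N}) (k l : 'I_N).

Definition esgn k A : R := (-1) ^+ #|[set l in A | (l < k)%N]|.

(** Contraction of the exterior chain [w] by the vector [a]. With [a] the vector of variables this
    is the Koszul differential; constant vectors are used for linear sections. *)
Definition bd a w B : R := \sum_(k | k \notin B) esgn k B * a k * w (k |: B).

Definition ext k w A : R := if k \in A then esgn k A * w (A :\ k) else 0.

Lemma esgnU k l B : l \notin B -> esgn k (l |: B) = (-1) ^+ (l < k)%N * esgn k B.
Proof.
move=> lB; rewrite /esgn -exprD; congr (_ ^+ _).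
rewrite (cardsD1 l) !inE eqxx /=; congr (_ + _)%N.
apply: eq_card => x; rewrite !inE; case: eqP => [->|] //=.
by rewrite (negbTE lB).
Qed.

Lemma esgnD1 k l B : l \in B -> esgn k B = (-1) ^+ (l < k)%N * esgn k (B :\ l).
Proof. by move=> lB; rewrite -{1}(setD1K lB) esgnU // setD11. Qed.

Lemma esgnn k B : esgn k (k |: B) = esgn k B.
Proof.
rewrite /esgn; congr (_ ^+ _); apply: eq_card => x; rewrite !inE.
by case: eqP => [->|] //=; rewrite ltnn andbF.
Qed.

Lemma esgn_sq k A : esgn k A * esgn k A = 1.
Proof. by rewrite /esgn -expr2 sqrr_sign. Qed.

Lemma signlt k l : k != l -> (-1) ^+ (l < k)%N = - (-1) ^+ (k < l)%N :> R.
Proof.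
by rewrite -val_eqE neq_ltn; case: ltngtP => //= _ _; rewrite expr0 expr1 ?opprK.
Qed.

Lemma eq_bd a w1 w2 : w1 =1 w2 -> bd a w1 =1 bd a w2.
Proof. by move=> e B; apply: eq_bigr => k _; rewrite e. Qed.

Lemma eq_ext k w1 w2 : w1 =1 w2 -> ext k w1 =1 ext k w2.
Proof. by move=> e B; rewrite /ext e. Qed.

Lemma bdD a w1 w2 B : bd a (fun A => w1 A + w2 A) B = bd a w1 B + bd a w2 B.
Proof. by rewrite /bd -big_split; apply: eq_bigr => k _ /=; rewrite mulrDr. Qed.

Lemma bdZ a c w B : bd a (fun A => c * w A) B = c * bd a w B.
Proof. by rewrite /bd mulr_sumr; apply: eq_bigr => k _ /=; ring. Qed.

Lemma bdB a w1 w2 B : bd a (fun A => w1 A - w2 A) B = bd a w1 B - bd a w2 B.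
Proof. by rewrite /bd -sumrB; apply: eq_bigr => k _ /=; rewrite mulrBr. Qed.

Lemma bd0 a B : bd a (fun=> 0) B = 0.
Proof. by rewrite /bd big1 // => k _; rewrite mulr0. Qed.

Lemma bd_sum (I : Type) (r : seq I) (P : pred I) a (F : I -> {set 'I_N} -> R) B :
  bd a (fun A => \sum_(i <- r | P i) F i A) B = \sum_(i <- r | P i) bd a (F i) B.
Proof.
rewrite /bd exchange_big /=; apply: eq_bigr => k _.
by rewrite mulr_sumr.
Qed.

Lemma bdaD a b w B : bd (fun k => a k + b k) w B = bd a w B + bd b w B.
Proof. by rewrite /bd -big_split; apply: eq_bigr => k _ /=; ring. Qed.

Lemma bdaZ c a w B : bd (fun k => c * a k) w B = c * bd a w B.
Proof. by rewrite /bd mulr_sumr; apply: eq_bigr => k _ /=; ring. Qed.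

Let bd2t a b w B k l :=
  if [&& k \notin B, l \notin B & k != l]
  then esgn k B * esgn l B * (-1) ^+ (k < l)%N * a k * b l * w (k |: (l |: B)) else 0.

Let bdbd a b w B : bd a (bd b w) B = \sum_k \sum_l bd2t a b w B k l.
Proof.
rewrite /bd big_mkcond /=; apply: eq_bigr => k _.
rewrite /bd2t; case: (boolP (k \in B)) => kB /=.
  by rewrite big1.
rewrite mulr_sumr big_mkcond /=; apply: eq_bigr => l _.
rewrite !inE negb_or andbC eq_sym.
case: ifP => // /andP[lB kl]; rewrite esgnU //.
by rewrite [l |: (k |: B)]setUCA; ring.
Qed.

Lemma bd_anti a b w B : bd a (bd b w) B = - bd b (bd a w) B.
Proof.
rewrite !bdbd exchange_big /= -sumrN; apply: eq_bigr => k _.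
rewrite -sumrN; apply: eq_bigr => l _.
rewrite /bd2t andbCA eq_sym; case: ifP; last by rewrite oppr0.
case/and3P=> _ _ kl; rewrite [k |: (l |: B)]setUCA (signlt kl); ring.
Qed.

(** Taking [b = a] in [bd_anti] only shows that twice the square vanishes. To cover characteristic
    2, the terms with l < k are cancelled against those with k < l. *)
Lemma bd_sq a w B : bd a (bd a w) B = 0.
Proof.
rewrite bdbd.
pose F := bd2t a a w B.
have Fanti k l : F k l = - F l k.
  rewrite /F /bd2t andbCA eq_sym; case: ifP; last by rewrite oppr0.
  case/and3P=> _ _ kl; rewrite [k |: (l |: B)]setUCA (signlt kl); ring.
have Fkk k : F k k = 0 by rewrite /F /bd2t eqxx !andbF.
transitivity (\sum_(k < N) (\sum_(l < N | (l < k)%N) F k l + \sum_(l < N | (k < l)%N) F k l)).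
  apply: eq_bigr => k _; rewrite (bigID (fun l : 'I_N => (l < k)%N)) /=; congr (_ + _).
  rewrite (bigID (fun l : 'I_N => (k < l)%N)) /= [X in _ + X]big1 ?addr0.
    by apply: eq_bigl => l; rewrite -leqNgt andb_idl // => /ltnW.
  move=> l /andP[]; rewrite -!leqNgt => h1 h2.
  by have /val_inj-> : val l = val k; [apply/eqP; rewrite eqn_leq h1 h2 | exact: Fkk].
rewrite big_split /= [X in _ + X](exchange_big_dep xpredT) //=.
by rewrite -big_split /= big1 // => k _; rewrite -big_split big1 //= => l _; rewrite Fanti addNr.
Qed.

(** The Leibniz rule: contraction is an antiderivation. *)
Lemma bd_ext a k w B : bd a (ext k w) B = a k * w B - ext k (bd a w) B.
Proof.
rewrite /ext /bd; case: (boolP (k \in B)) => kB; last first.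
  rewrite (bigD1 k) //= setU11 esgnn setU1K //=.
  rewrite big1 ?addr0 ?subr0.
    have := esgn_sq k B; set e := esgn k B => ee.
    rewrite [LHS](_ : _ = (e * e) * (a k * w B)); first by rewrite ee mul1r.
    by ring.
  by move=> l /andP[lB lk]; rewrite !inE (negbTE kB) orbF eq_sym (negbTE lk) mulr0.
rewrite [X in _ - _ * X](bigD1 k) ?setD11 //= setD1K // mulrDr.
have -> : esgn k B = esgn k (B :\ k) by rewrite -[RHS]esgnn setD1K.
have ee := esgn_sq k (B :\ k); set e := esgn k (B :\ k) in ee *.
rewrite [X in _ - (X + _)](_ : _ = (e * e) * (a k * w B)); last by ring.
rewrite ee mul1r opprD addrA subrr add0r mulr_sumr -sumrN.
apply: eq_big => l.
  by rewrite !inE; case: eqP => [->|_] /=; rewrite ?kB ?andbT.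
move=> lB; have lk : k != l by apply: contraNneq lB => <-.
rewrite inE kB orbT esgnU // (esgnD1 l kB) (signlt lk).
have -> : esgn k B = e by rewrite /e -[RHS]esgnn setD1K.
have -> : (l |: B) :\ k = l |: (B :\ k).
  by apply/setP=> x; rewrite !inE; case: (eqVneq x l) => [->|]; rewrite ?andbT // eq_sym lk.
set s := (-1) ^+ _; have ss : s * s = 1 by rewrite -expr2 sqrr_sign.
rewrite (_ : s * esgn l (B :\ k) * a l * (- s * e * w (l |: B :\ k)) =
  (s * s) * - (e * (esgn l (B :\ k) * a l * w (l |: B :\ k)))); last by ring.
by rewrite ss mul1r.
Qed.

(** The tuple [t] = (p, q, (k, l)) encodes the 1-form p e_k - q e_l, multiplied here onto [w];
    [wval] is its pairing with a vector. *)
Definition wdg (t : R * R * ('I_N * 'I_N)) w A : R :=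
  t.1.1 * ext t.2.1 w A - t.1.2 * ext t.2.2 w A.

Definition wval a (t : R * R * ('I_N * 'I_N)) : R := t.1.1 * a t.2.1 - t.1.2 * a t.2.2.

Definition unit_chain A : R := if A == set0 then 1 else 0.

Implicit Types t : R * R * ('I_N * 'I_N).

Lemma eq_wdg t w1 w2 : w1 =1 w2 -> wdg t w1 =1 wdg t w2.
Proof. by move=> h A; rewrite /wdg !(eq_ext _ h). Qed.

Lemma bd_wdg a t w B : bd a (wdg t w) B = wval a t * w B - wdg t (bd a w) B.
Proof. by rewrite /wdg bdB !bdZ !bd_ext /wval; ring. Qed.

Lemma wdgB t c1 c2 w1 w2 A :
  wdg t (fun A => c1 * w1 A - c2 * w2 A) A = c1 * wdg t w1 A - c2 * wdg t w2 A.
Proof. by rewrite /wdg /ext; do 2!case: ifP => _; ring. Qed.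

Lemma wdgZ t c w A : wdg t (fun A => c * w A) A = c * wdg t w A.
Proof. by rewrite /wdg /ext; do 2!case: ifP => _; ring. Qed.

Lemma wdg0 t w A : (forall B, w B = 0) -> wdg t w A = 0.
Proof. by move=> h; rewrite /wdg /ext; do 2!case: ifP => _; rewrite ?h !mulr0 subrr. Qed.

Lemma bd_unit_chain a B : bd a unit_chain B = 0.
Proof.
apply: big1 => k kB; rewrite /unit_chain; case: eqP => [/setP/(_ k)|]; rewrite ?mulr0 //.
by rewrite !inE eqxx.
Qed.

Lemma bd_wdg1 a t B : bd a (wdg t unit_chain) B = wval a t * unit_chain B.
Proof. by rewrite bd_wdg wdg0 ?subr0 // => C; apply: bd_unit_chain. Qed.

Lemma bd_wdg2 a t1 t2 B : bd a (wdg t1 (wdg t2 unit_chain)) B =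
  wval a t1 * wdg t2 unit_chain B - wval a t2 * wdg t1 unit_chain B.
Proof. by rewrite bd_wdg (eq_wdg _ (bd_wdg1 _ _)) wdgZ. Qed.

(** The determinant of the pairings with rows [a2], [a1], [a0] and columns [t1], [t2], [t3],
    expanded along the first row. *)
Definition wdet a0 a1 a2 t1 t2 t3 : R :=
  wval a2 t1 * (wval a1 t2 * wval a0 t3 - wval a1 t3 * wval a0 t2)
  - wval a2 t2 * (wval a1 t1 * wval a0 t3 - wval a1 t3 * wval a0 t1)
  + wval a2 t3 * (wval a1 t1 * wval a0 t2 - wval a1 t2 * wval a0 t1).

Lemma bd_wdg3 a0 a1 a2 t1 t2 t3 :
  bd a0 (bd a1 (bd a2 (wdg t1 (wdg t2 (wdg t3 unit_chain))))) set0 = wdet a0 a1 a2 t1 t2 t3.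
Proof.
pose d2 s t := wdg s (wdg t unit_chain).
have s1 B : bd a2 (wdg t1 (wdg t2 (wdg t3 unit_chain))) B =
    (wval a2 t1 * d2 t2 t3 B - wval a2 t2 * d2 t1 t3 B) + wval a2 t3 * d2 t1 t2 B.
  by rewrite bd_wdg (eq_wdg _ (bd_wdg2 _ _ _)) wdgB /d2 opprB addrA addrAC.
rewrite (eq_bd _ (eq_bd _ s1)).
have s2 B : bd a1 (fun B => (wval a2 t1 * d2 t2 t3 B - wval a2 t2 * d2 t1 t3 B)
    + wval a2 t3 * d2 t1 t2 B) B =
    (wval a2 t1 * bd a1 (d2 t2 t3) B - wval a2 t2 * bd a1 (d2 t1 t3) B)
    + wval a2 t3 * bd a1 (d2 t1 t2) B.
  by rewrite bdD bdB !bdZ.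
rewrite (eq_bd _ s2) bdD bdB !bdZ.
have s3 s t : bd a0 (bd a1 (d2 s t)) set0 = wval a1 s * wval a0 t - wval a1 t * wval a0 s.
  by rewrite (eq_bd _ (bd_wdg2 _ _ _)) bdB !bdZ !bd_wdg1 /unit_chain eqxx !mulr1.
by rewrite !s3.
Qed.

(** Contractions anticommute and square to zero, and each inner contraction meets its own copy
    outside. *)
Lemma bd_triple a0 a1 a2 x0 x1 x2 w B :
  bd a0 (bd a1 (bd a2 (fun B => x0 * bd a0 w B + x1 * bd a1 w B + x2 * bd a2 w B))) B = 0.
Proof.
have e1 C : bd a2 (fun B => x0 * bd a0 w B + x1 * bd a1 w B + x2 * bd a2 w B) C
    = x0 * bd a2 (bd a0 w) C + x1 * bd a2 (bd a1 w) C.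
  by rewrite !bdD !bdZ bd_sq mulr0 addr0.
rewrite (eq_bd _ (eq_bd _ e1)).
have e2 C : bd a1 (fun B => x0 * bd a2 (bd a0 w) B + x1 * bd a2 (bd a1 w) B) C
    = x0 * bd a1 (bd a2 (bd a0 w)) C.
  rewrite bdD !bdZ bd_anti [bd a1 (bd a2 (bd a1 w)) C]bd_anti (eq_bd _ (bd_sq _ _)) bd0.
  by rewrite oppr0 mulr0 addr0 bd_anti opprK.
rewrite (eq_bd _ e2) bdZ.
have e3 C : bd a1 (bd a2 (bd a0 w)) C = -1 * bd a1 (bd a0 (bd a2 w)) C.
  by rewrite -bdZ; apply: eq_bd => D; rewrite bd_anti mulN1r.
have e4 C : bd a1 (bd a2 (bd a0 w)) C = bd a0 (bd a1 (bd a2 w)) C.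
  by rewrite e3 mulN1r bd_anti opprK.
by rewrite (eq_bd _ e4) bd_sq mulr0.
Qed.

End Exterior.

(** * Chains and graded Betti numbers *)

Section MpolyFacts.
Variables (K : fieldType) (N : nat).
Implicit Types (p : {mpoly K[N]}) (m : 'X_{1..N}).

Lemma mcoeff_XM p m0 m :
  ('X_[m0] * p)@_m = if (m0 <= m)%MM then p@_(m - m0)%MM else 0.
Proof.
case: ifP => h; first by have := mcoeffMX p m0 (m - m0)%MM; rewrite addmC submK // mulrC.
apply/memN_msupp_eq0; rewrite mulrC (perm_mem (msuppMX _ _)).
apply/negP => /mapP[m1 _ e]; move: h; rewrite e.
by rewrite (_ : (m0 <= m0 + m1)%MM = true) //; apply: lem_addr.
Qed.

Lemma dhomog_coeff d p m : p \is d.-homog -> mdeg m != d -> p@_m = 0.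
Proof. exact: dhomog_nemf_coeff. Qed.

Lemma pihomogZM d e p g : g \is e.-homog ->
  pihomog mdeg (d + e) (p * g) = pihomog mdeg d p * g.
Proof.
move=> hg; rewrite {1}(mpolyE p) big_distrl /= raddf_sum /=.
rewrite [in RHS](mpolyE p) raddf_sum big_distrl /=; apply: eq_bigr => m _.
rewrite linearZ /= pihomogX.
have hm : p@_m *: 'X_[m] * g \is (mdeg m + e)%N.-homog.
  by apply: dhomogM => //; rewrite dhomogZ // dhomogX.
case: eqP => [<-|/eqP ne]; first by rewrite pihomog_dE.
rewrite scaler0 mul0r (pihomog_ne0 _ hm) //.
by rewrite eqn_add2r.
Qed.

Lemma pihomogZM_lt d e p g : g \is e.-homog -> (d < e)%N ->
  pihomog mdeg d (p * g) = 0.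
Proof.
move=> hg de; rewrite {1}(mpolyE p) big_distrl /= raddf_sum /=.
apply: big1 => m _.
have hm : p@_m *: 'X_[m] * g \is (mdeg m + e)%N.-homog.
  by apply: dhomogM => //; rewrite dhomogZ // dhomogX.
rewrite (pihomog_ne0 _ hm) //; apply/eqP; lia.
Qed.

Lemma dhomog0_const p : p \is 0.-homog -> p = (p@_0)%:MP.
Proof.
move=> hp; apply/mpolyP => m; rewrite mcoeffC.
case: eqP => [->|/eqP ne]; first by rewrite mulr1.
by rewrite mulr0 (dhomog_coeff hp) // mdeg_eq0.
Qed.

Lemma dhomogX1 (k : 'I_N) : 'X_k \is [in K[N], 1.-homog].
Proof. by rewrite dhomogX /= mdeg1. Qed.

End MpolyFacts.

(** * Subspaces as row spaces *)

Section Subspace.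
Variables (K : fieldType) (n : nat).

(** Vectors of [P] outside the current row space are adjoined until none is left; each one raises
    the rank, which cannot exceed n. *)
Lemma subspace_mx (P : 'rV[K]_n -> Prop) :
  P 0 -> (forall u v, P u -> P v -> P (u + v)) -> (forall c u, P u -> P (c *: u)) ->
  exists M : 'M[K]_n, forall v, (v <= M)%MS <-> P v.
Proof.
move=> P0 PD PZ.
have main k (M : 'M[K]_n) : (n - \rank M <= k)%N -> (forall v : 'rV_n, (v <= M)%MS -> P v) ->
    exists M : 'M[K]_n, forall v, (v <= M)%MS <-> P v.
  have grow M0 : ~ (forall v, P v -> (v <= M0)%MS) ->
      exists2 v : 'rV_n, P v & (\rank M0 < \rank (M0 + v)%MS)%N.
    move=> h; have [v hv] := not_all_ex_not _ _ h.
    have [Pv /negP nv] := imply_to_and _ _ hv; exists v => //.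
    rewrite ltn_neqAle mxrankS ?addsmxSl // andbT; apply: contra nv => e.
    apply: (submx_trans (addsmxSr M0 v)).
    by move: (mxrank_leqif_sup (addsmxSl M0 v)) => [_ <-].
  elim: k M => [|k IH] M hk hM.
    have [hall|/grow[v _ lt]] := classic (forall v, P v -> (v <= M)%MS).
      by exists M => v; split; [apply: hM | apply: hall].
    by have := rank_leq_col (M + v)%MS; lia.
  have [hall|/grow[v Pv lt]] := classic (forall v, P v -> (v <= M)%MS).
    by exists M => v; split; [apply: hM | apply: hall].
  apply: (IH (M + v)%MS); first by have := rank_leq_col (M + v)%MS; lia.
  move=> u /sub_addsmxP[[a b] /= ->]; apply: PD; first by apply: hM; apply: submxMl.
  by rewrite [b]mx11_scalar mul_scalar_mx; apply: PZ.
by apply: (main n 0); [lia | move=> v; rewrite submx0 => /eqP->].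
Qed.

End Subspace.

(** * Koszul cycles and boundaries, in coordinates and as functions *)

Section Betti.
Variables (K : fieldType) (N : nat).
Notation S := {mpoly K[N]}.
Implicit Types (p : S) (w : {set 'I_N} -> S) (A B : {set 'I_N}) (I : S -> Prop).

Definition zv (k : 'I_N) : S := 'X_k.

Definition idealP I := [/\ I 0, forall p q, I p -> I q -> I (p + q) & forall a p, I p -> I (a * p)].

Lemma idealZ I c p : idealP I -> I p -> I (c *: p).
Proof. by case=> _ _ h /(h c%:MP); rewrite mul_mpolyC. Qed.

Lemma idealN I p : idealP I -> I p -> I (- p).
Proof. by case=> _ _ h /(h (-1)); rewrite mulN1r. Qed.

Lemma idealB I p q : idealP I -> I p -> I q -> I (p - q).
Proof. by move=> hI hp hq; case: (hI) => _ h _; apply: h => //; apply: idealN. Qed.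

Lemma ideal_sum I (T : Type) (r : seq T) (P : pred T) (F : T -> S) :
  idealP I -> (forall i, P i -> I (F i)) -> I (\sum_(i <- r | P i) F i).
Proof. by case=> h0 hD _ h; apply: (big_ind I). Qed.

Definition is_chain i d w := forall A, w A \is d.-homog /\ (#|A| != i -> w A = 0).

Lemma is_chain_homog i d w A : is_chain i d w -> w A \is d.-homog.
Proof. by move=> /(_ A)[]. Qed.

Lemma is_chain_bd i d w : is_chain i.+1 d w -> is_chain i d.+1 (bd zv w).
Proof.
move=> h B; split.
  apply: rpred_sum => k _; rewrite /esgn mulrC -signr_odd -(addn1 d).
  have hX : zv k * w (k |: B) \is (1 + d)%N.-homog.
    by apply: dhomogM; [apply: dhomogX1 | case: (h (k |: B))].
  rewrite mulrC -mulrA addn1 -add1n.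
  by case: (odd _); rewrite ?expr1 ?expr0 ?mulN1r ?mul1r ?rpredN.
move=> cB; apply: big1 => k kB; have [_ ->] := h (k |: B); rewrite ?mulr0 //.
by rewrite cardsU1 kB.
Qed.

Lemma is_chain_bd0 d w B : is_chain 0 d w -> bd zv w B = 0.
Proof.
move=> h; apply: big1 => k kB; have [_ ->] := h (k |: B); rewrite ?mulr0 //.
by rewrite cardsU1 kB.
Qed.

Lemma iscB i d w1 w2 : is_chain i d w1 -> is_chain i d w2 -> is_chain i d (fun A => w1 A - w2 A).
Proof.
move=> h1 h2 A; have [h1a h1b] := h1 A; have [h2a h2b] := h2 A.
by split=> [|c]; [rewrite rpredB | rewrite h1b // h2b // subr0].
Qed.

Lemma iscM i d e w p : is_chain i d w -> p \is e.-homog -> is_chain i (e + d) (fun A => p * w A).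
Proof.
move=> h hp A; have [ha hb] := h A.
by split=> [|c]; [apply: dhomogM | rewrite hb ?mulr0].
Qed.

Definition rowc i d w : 'rV[K]_(nK N i d) :=
  \row_q (w (val (enum_val q : KB N i d).1))@_(mon (enum_val q : KB N i d).2).

Definition chainc i d (v : 'rV[K]_(nK N i d)) A : S :=
  \sum_q (if val (enum_val q : KB N i d).1 == A
          then v 0 q *: 'X_[mon (enum_val q : KB N i d).2] else 0).

Lemma mon_mdeg d (m : Mon N d) : mdeg (mon m) = d.
Proof. exact: (eqP (valP m)). Qed.

Lemma mon_inj d : injective (@mon N d).
Proof. by move=> m1 m2 e; apply/val_inj/val_inj. Qed.

Lemma mon_ex d m : mdeg m = d -> exists r : Mon N d, mon r = m.
Proof.
move=> e; have h : (mdeg m < d.+1)%N by rewrite e.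
have h2 : mdeg (bmnm (BMultinom h)) == d by apply/eqP.
by exists (Sub (BMultinom h) h2).
Qed.

Lemma chainc_isc i d v : is_chain i d (@chainc i d v).
Proof.
move=> A; split.
  by apply: rpred_sum => q _; case: ifP => _; rewrite ?rpred0 // dhomogZ // dhomogX /= mon_mdeg.
move=> c; apply: big1 => q _; case: eqP => // e.
by move: c; rewrite -e (valP (enum_val q).1).
Qed.

Lemma chaincK i d v : rowc i d (chainc v) = v.
Proof.
apply/rowP => q; rewrite !mxE raddf_sum /= (bigD1 q) //= eqxx mcoeffZ mcoeffX eqxx mulr1.
rewrite big1 ?addr0 // => q' ne; case: eqP => [e1|]; last by rewrite mcoeff0.
rewrite mcoeffZ mcoeffX; case: eqP => [e2|]; last by rewrite mulr0.
case/negP: ne; apply/eqP/enum_val_inj; move: e1 e2.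
by case: (enum_val q) (enum_val q') => A m [A' m'] /= /val_inj-> /mon_inj->.
Qed.

Lemma rowcB i d w1 w2 : rowc i d (fun A => w1 A - w2 A) = rowc i d w1 - rowc i d w2.
Proof. by apply/rowP => q; rewrite !mxE mcoeffB. Qed.

(** Allows every statement about the matrix [Dk] to be proved on functions, with [bd] in its
    place. *)
Lemma rowc_bd i d w : is_chain i.+1 d w -> rowc i d.+1 (bd zv w) = rowc i.+1 d w *m Dk K N i.+1 d.
Proof.
move=> hw; apply/rowP => q; rewrite !mxE.
case eq_q : (enum_val q) => [B m'] /=.
pose G (x : KB N i.+1 d) := (w (val x.1))@_(mon x.2) *
   (\sum_(k < N | k \in val x.1)
       (if (val B == val x.1 :\ k) && (mon m' == (mon x.2 + mnm1 k)%MM)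
        then (-1) ^+ #|[set l in val x.1 | (l < k)%N]| else 0)).
transitivity (\sum_x G x); last first.
  rewrite (@big_enum_val _ _ _ _ {: KB N i.+1 d}) /=; apply: eq_bigr => p _.
  by rewrite !mxE /G eq_q; case: (enum_val p).
rewrite /G; under eq_bigr => x _ do rewrite big_distrr /= big_mkcond.
rewrite exchange_big /= /bd raddf_sum /= big_mkcond; apply: eq_bigr => k _ /=.
case: (boolP (k \in val B)) => kB /=.
  rewrite big1 // => x _; case: ifP => // _; case: eqP => [e|]; last by rewrite mulr0.
  have : k \in val x.1 :\ k by rewrite -e; exact: kB.
  by rewrite setD11.
rewrite /esgn -mulrA -signr_odd mulr_sign.
have -> : (if odd #|[set l in val B | (l < k)%N]| then - (zv k * w (k |: val B)) else zv k * w (k |: val B))@_(mon m')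
   = (-1) ^+ #|[set l in val B | (l < k)%N]| * (zv k * w (k |: val B))@_(mon m').
  by rewrite -[in RHS]signr_odd mulr_sign; case: odd; rewrite ?mcoeffN.
rewrite /zv mcoeff_XM; case: ifP => hk; last first.
  rewrite mulr0 big1 // => x _; case: ifP => // _; case: eqP => //= _; last by rewrite mulr0.
  case: eqP => e; last by rewrite mulr0.
  by move: hk; rewrite e (_ : lem _ _ = true) //; apply: lem_addl.
have cA : #|k |: val B| == i.+1 by rewrite cardsU1 kB (eqP (valP B)).
have [|r er] := @mon_ex d (mon m' - U_(k)).
  have := mon_mdeg m'; rewrite -{1}(submK hk) mdegD mdeg1; lia.
rewrite (bigD1 (Sub (k |: val B) cA, r)) //= er.
rewrite setU11 setU1K // eqxx submK // eqxx /=.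
rewrite big1 ?addr0.
  rewrite mulrC; congr (_ * _ ^+ _); apply: eq_card => x; rewrite !inE.
  by case: eqP => [->|] //=; rewrite ltnn andbF.
move=> [A m] /=; rewrite -pair_eqE /= => ne; case: ifP => // kA.
case: eqP => //= [eB|]; last by rewrite mulr0.
case: eqP => //= [em|]; last by rewrite mulr0.
case/negP: ne; apply/andP; split; apply/eqP.
  by apply: val_inj; rewrite /= eB setD1K.
by apply: mon_inj; rewrite er em addmK.
Qed.

Lemma polyOf_row d p : p \is d.-homog -> polyOf (\row_(r < nM N d) p@_(mon (enum_val r))) = p.
Proof.
move=> hp; apply/mpolyP => m; rewrite /polyOf raddf_sum /=.
under eq_bigr => r _ do rewrite mxE mcoeffZ mcoeffX.
have [e|ne] := eqVneq (mdeg m) d; last first.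
  rewrite (dhomog_coeff hp ne) big1 // => r _; case: eqP => [e|]; last by rewrite mulr0.
  by move: ne; rewrite -e mon_mdeg eqxx.
have [r er] := mon_ex e.
rewrite (bigD1 (enum_rank r)) //= enum_rankK er eqxx mulr1 big1 ?addr0 // => r' ne.
case: eqP => [e'|]; last by rewrite mulr0.
case/negP: ne; apply/eqP; apply: enum_val_inj; rewrite enum_rankK.
by apply: mon_inj; rewrite e' er.
Qed.

(** [IK] is block diagonal, with one copy of the degree-d piece of I for each subset, so membership
    can be tested block by block. *)
Lemma IKP I (Id : forall d, 'M[K]_(nM N d)) i d w :
  idealP I -> represents I Id -> is_chain i d w ->
  (rowc i d w <= IK Id i d)%MS <-> (forall A, I (w A)).
Proof.
move=> [I0 _ _] hId hw.
pose bl A : 'rV[K]_(nM N d) := \row_r (w A)@_(mon (enum_val r)).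
have blP A : (bl A <= Id d)%MS <-> I (w A).
  by rewrite (hId d (bl A)) polyOf_row //; case: (hw A).
have mulIK (y : 'rV[K]_(nK N i d)) q : (y *m IK Id i d) 0 q =
    ((\row_r y 0 (enum_rank ((enum_val q : KB N i d).1, enum_val r))) *m Id d) 0
       (enum_rank (enum_val q : KB N i d).2).
  rewrite !mxE; case eq_q : (enum_val q) => [B m] /=.
  pose G (x : KB N i d) := y 0 (enum_rank x) *
     (if x.1 == B then Id d (enum_rank x.2) (enum_rank m) else 0).
  transitivity (\sum_x G x).
    rewrite (@big_enum_val _ _ _ _ {: KB N i d}) /=; apply: eq_bigr => p _.
    by rewrite !mxE /G eq_q enum_valK; case: (enum_val p).
  transitivity (\sum_(A : {A : {set 'I_N} | #|A| == i}) \sum_(r : Mon N d) G (A, r)).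
    by rewrite pair_bigA; apply: eq_bigr => -[].
  rewrite (bigD1 B) //= [X in _ + X]big1 ?addr0.
    rewrite (@big_enum_val _ _ _ _ {: Mon N d}) /=; apply: eq_bigr => r _.
    by rewrite /G /= eqxx mxE enum_valK.
  by move=> A ne; apply: big1 => r _; rewrite /G /= (negbTE ne) mulr0.
split.
  case/submxP => y hy A.
  have [cA|ne] := boolP (#|A| == i); last by have [_ ->] := hw A.
  apply/blP; pose B : {A : {set 'I_N} | #|A| == i} := Sub A cA.
  apply/submxP; exists (\row_r y 0 (enum_rank (B, enum_val r))).
  apply/rowP => m; have := congr1 (fun v : 'rV_(nK N i d) => v 0 (enum_rank (B, enum_val m))) hy.
  by rewrite /rowc mulIK !mxE enum_rankK /= enum_valK.
move=> h; apply/submxP.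
have hy A : exists y, bl A = y *m Id d by apply/submxP/blP.
pose yy A := epsilon (inhabits (0 : 'rV[K]_(nM N d))) (fun y => bl A = y *m Id d).
have yyP A : bl A = yy A *m Id d by apply: (epsilon_spec (inhabits 0) (fun y => bl A = y *m Id d)).
exists (\row_q yy (val (enum_val q : KB N i d).1) 0 (enum_rank (enum_val q : KB N i d).2)).
apply/rowP => q; rewrite mulIK.
have -> : \row_r (\row_q0 yy (val (enum_val q0 : KB N i d).1) 0 (enum_rank (enum_val q0 : KB N i d).2)) 0
     (enum_rank ((enum_val q : KB N i d).1, enum_val r)) = yy (val (enum_val q : KB N i d).1).
  by apply/rowP => r; rewrite !mxE enum_rankK /= enum_valK.
by rewrite -yyP !mxE enum_rankK.
Qed.

Lemma polyOfD d (u v : 'rV[K]_(nM N d)) : polyOf (u + v) = polyOf u + polyOf v.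
Proof. by rewrite /polyOf -big_split; apply: eq_bigr => i _; rewrite mxE scalerDl. Qed.

Lemma polyOfZ d c (u : 'rV[K]_(nM N d)) : polyOf (c *: u) = c *: polyOf u.
Proof. by rewrite /polyOf scaler_sumr; apply: eq_bigr => i _; rewrite mxE scalerA. Qed.

Lemma representable I : idealP I -> exists Id, represents I Id.
Proof.
move=> hI; have [I0 ID _] := hI.
have h d : exists M : 'M[K]_(nM N d), forall v, (v <= M)%MS <-> I (polyOf v).
  apply: subspace_mx.
  - by rewrite /polyOf big1 // => i _; rewrite mxE scale0r.
  - by move=> u v; rewrite polyOfD; apply: ID.
  - by move=> c u; rewrite polyOfZ; apply: idealZ.
exists (fun d => epsilon (inhabits 0) (fun M : 'M[K]_(nM N d) => forall v, (v <= M)%MS <-> I (polyOf v))).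
by move=> d; apply: (epsilon_spec (inhabits 0) (fun M : 'M[K]_(nM N d) => forall v, (v <= M)%MS <-> I (polyOf v)) (h d)).
Qed.

(** [betti] rests on an arbitrary choice of matrices; for an ideal, representing matrices exist, so
    the chosen ones do represent it. *)
Lemma betti_repr I i j : idealP I -> exists2 Id, represents I Id & betti I i j = betti_mx Id i j.
Proof.
move=> hI; exists (epsilon (inhabited_pieces K N) (represents I)) => //.
exact: (epsilon_spec (inhabited_pieces K N)) (representable hI).
Qed.

(** Exactness of the Koszul complex of S/I in exterior degree i and polynomial degree d + 1, hence
    in total degree i + d + 1, phrased on lifts to S. *)
Definition tor_vanish I i d := forall w, is_chain i d.+1 w -> (forall A, I (bd zv w A)) ->
  exists2 t, is_chain i.+1 d t & forall A, I (w A - bd zv t A).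

Lemma tor_vanish_betti I i d : idealP I -> tor_vanish I i d -> betti I i (i + d.+1) = 0%N.
Proof.
move=> hI hv; have [Id hId ->] := betti_repr i (i + d.+1) hI.
rewrite /betti_mx leq_addr addKn; apply/eqP; rewrite subn_eq0; apply: mxrankS.
apply/row_subP => r; move: (row r _) (row_sub r (cycles Id i d.+1)) => v hv'.
pose w := chainc v; have hw : is_chain i d.+1 w := chainc_isc v.
have {hv'} cyc : forall A, I (bd zv w A).
  have [I0 _ _] := hI.
  (* For i = 0 [cycles] is the whole space, which agrees with the differential of a 0-chain being
     zero. *)
  case: i v @w hw hv' {hv r} => [|i] v w hw hv' A; first by rewrite (is_chain_bd0 _ hw).
  move: A; apply/(IKP (i := i) (d := d.+2) hI hId); first exact: is_chain_bd.
  rewrite rowc_bd // chaincK submxE -mulmxA -sub_kermx.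
  by move: hv'; rewrite /cycles /=.
have [t ht hwt] := hv w hw cyc.
rewrite /bounds -(chaincK v) -/w.
have -> : rowc i d.+1 w = rowc i d.+1 (fun A => w A - bd zv t A) + rowc i d.+1 (bd zv t).
  by rewrite rowcB subrK.
rewrite (submx_trans (addmx_sub_adds (submx_refl _) (submx_refl _))) //.
apply: addsmxS; first by apply/(IKP hI hId) => //; apply: iscB => //; apply: is_chain_bd.
by rewrite rowc_bd // submxMl.
Qed.

(** For k in A, the coefficient of z_k in the differential at A \ k is the constant w(A) up to sign.
    This needs A nonempty, hence the positive exterior degree. *)
Lemma bd_const0 i w : is_chain i.+1 0 w -> (forall A, bd zv w A = 0) -> forall A, w A = 0.
Proof.
move=> hw cyc A.
have [/eqP cA|ne] := boolP (#|A| == i.+1); last by have [_ ->] := hw A.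
have [k kA] : exists k, k \in A by apply/card_gt0P; rewrite cA.
have := congr1 (fun p : S => p@_U_(k)) (cyc (A :\ k)).
rewrite mcoeff0 /bd raddf_sum /= (bigD1 k) ?setD11 //= setD1K //.
have /dhomog0_const -> : w A \is 0.-homog by case: (hw A).
rewrite big1 ?addr0.
  rewrite /esgn -mulrA -signr_odd mulr_sign mulrC mul_mpolyC /zv => h.
  have : (w A)@_0 == 0.
    by move: h; case: odd; rewrite ?mcoeffN mcoeffZ mcoeffX eqxx mulr1 => /eqP; rewrite ?oppr_eq0.
  by move/eqP->; rewrite mpolyC0.
move=> l /andP[_ lk].
have /dhomog0_const -> : w (l |: A :\ k) \is 0.-homog by case: (hw (l |: A :\ k)).
rewrite mulrC mul_mpolyC mcoeffZ /esgn /zv -signr_odd mulr_sign.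
have e0 : ('X_l : S)@_U_(k) = 0 by rewrite mcoeffX eq_mnm1 (negbTE lk).
by case: odd; rewrite ?mcoeffN e0 ?oppr0 mulr0.
Qed.

(** On the diagonal a cycle has constant coefficients, so its differential takes linear forms of I
    as values and is zero in S itself. *)
Lemma betti_ii I i : idealP I -> (forall p, p \is 1.-homog -> I p -> p = 0) ->
  betti I i.+1 i.+1 = 0%N.
Proof.
move=> hI h1; have [Id hId ->] := betti_repr i.+1 i.+1 hI.
rewrite /betti_mx leqnn subnn; apply/eqP; rewrite subn_eq0; apply: mxrankS.
apply/row_subP => r; set v := row r _.
have hv' : (v <= cycles Id i.+1 0)%MS by apply: row_sub.
pose w := chainc v; have hw : is_chain i.+1 0 w := chainc_isc v.
have cyc : forall A, bd zv w A = 0.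
  move=> A; apply: h1; first by case: (is_chain_bd hw A).
  move: A; apply/(IKP (i := i) (d := 1) hI hId); first exact: is_chain_bd.
  rewrite rowc_bd // chaincK submxE -mulmxA -sub_kermx.
  by move: hv'; rewrite /cycles /=.
rewrite -(chaincK v) -/w (_ : rowc _ _ w = 0) ?sub0mx //.
by apply/rowP => q; rewrite !mxE (bd_const0 hw cyc) mcoeff0.
Qed.

Lemma bounds_cycles I (Id : forall d, 'M[K]_(nM N d)) i d :
  idealP I -> represents I Id -> (bounds Id i.+1 d.+1 <= cycles Id i.+1 d.+1)%MS.
Proof.
move=> hI hId; have [I0 ID IM] := hI.
rewrite /bounds /cycles /= addsmx_sub; apply/andP; split; apply/row_subP => r; set v := row r _.
  apply/sub_kermxP; rewrite mulmxA; apply/eqP; rewrite -submxE.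
  have hv : (v <= IK Id i.+1 d.+1)%MS by apply: row_sub.
  have := chaincK v; set w := chainc v => e.
  have hw : is_chain i.+1 d.+1 w := chainc_isc v.
  rewrite -e -rowc_bd //; apply/(IKP hI hId); first exact: is_chain_bd.
  have {}hv : forall A, I (w A) by apply/(IKP hI hId hw); rewrite e.
  by move=> A; apply: ideal_sum => // k _; apply: IM.
have hv : (v <= Dk K N i.+2 d)%MS by apply: row_sub.
case/submxP: hv => y ->.
have := chaincK y; set w := chainc y => e.
have hw : is_chain i.+2 d w := chainc_isc y.
apply/sub_kermxP; rewrite mulmxA -e -rowc_bd // -rowc_bd; last exact: is_chain_bd.
rewrite (_ : rowc _ _ _ = 0) ?mul0mx //.
by apply/rowP => q; rewrite !mxE bd_sq mcoeff0.
Qed.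

(** The span of the cycles [u t] has dimension #|T| and meets the boundaries in zero, so the two
    ranks add up inside [cycles]. *)
Lemma betti_lower I i d (T : finType) (u : T -> {set 'I_N} -> S) :
  idealP I -> (forall t, is_chain i.+1 d.+1 (u t)) -> (forall t A, I (bd zv (u t) A)) ->
  (forall (c : T -> K) th, is_chain i.+2 d th ->
     (forall A, I (\sum_t c t *: u t A - bd zv th A)) -> forall t, c t = 0) ->
  (#|T| <= betti I i.+1 (i.+1 + d.+1))%N.
Proof.
move=> hI hu cyc indep; have [Id hId ->] := betti_repr i.+1 (i.+1 + d.+1) hI.
have [I0 _ _] := hI.
rewrite /betti_mx leq_addr addKn.
pose U : 'M[K]_(#|T|, nK N i.+1 d.+1) := \matrix_(a < #|T|) rowc i.+1 d.+1 (u (enum_val a)).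
have iscL (c : T -> K) : is_chain i.+1 d.+1 (fun A => \sum_t c t *: u t A).
  move=> A; split; last by move=> cA; apply: big1 => t _; have [_ ->] := hu t A; rewrite // scaler0.
  by apply: rpred_sum => t _; rewrite dhomogZ //; case: (hu t A).
have UE (y : 'rV[K]_#|T|) : y *m U = rowc i.+1 d.+1 (fun A => \sum_t y 0 (enum_rank t) *: u t A).
  apply/rowP => q; rewrite !mxE raddf_sum /= (@big_enum_val _ _ _ _ {: T}) /=.
  by apply: eq_bigr => a _; rewrite !mxE mcoeffZ enum_valK.
have key (y : 'rV[K]_#|T|) : (y *m U <= bounds Id i.+1 d.+1)%MS -> y = 0.
  rewrite /bounds => /sub_addsmxP[[a b] /= e].
  have := chaincK b; set th := chainc b => eb.
  have hth : is_chain i.+2 d th := chainc_isc b.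
  have hI2 : forall A, I (\sum_t y 0 (enum_rank t) *: u t A - bd zv th A).
    apply/(IKP (i := i.+1) (d := d.+1) hI hId).
      by apply: iscB; [apply: (iscL (fun t => y 0 (enum_rank t))) | apply: is_chain_bd].
    by rewrite rowcB -UE rowc_bd // eb e addrK submxMl.
  have h := indep (fun t => y 0 (enum_rank t)) th hth hI2.
  by apply/rowP => a0; rewrite mxE -(enum_valK a0) h.
have Ucyc : (U <= cycles Id i.+1 d.+1)%MS.
  apply/row_subP => a; rewrite rowK /cycles /=; apply/sub_kermxP.
  rewrite mulmxA; apply/eqP; rewrite -submxE -rowc_bd //.
  by apply/(IKP hI hId); [apply: is_chain_bd | move=> A; apply: cyc].
have Ufree : row_free U.
  by rewrite -kermx_eq0; apply/eqP/row_matrixP => a; rewrite row0; apply: key;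
    rewrite -row_mul mulmx_ker row0 sub0mx.
have cap0 : (bounds Id i.+1 d.+1 :&: U)%MS = 0.
  apply/eqP; rewrite -submx0; apply/row_subP => a; set v := row a _.
  have : (v <= bounds Id i.+1 d.+1 :&: U)%MS by apply: row_sub.
  rewrite sub_capmx => /andP[h1 /submxP[y hy]].
  by rewrite hy (key y) ?mul0mx ?sub0mx // -hy.
have := mxrank_sum_cap (bounds Id i.+1 d.+1) U.
rewrite cap0 mxrank0 addn0 (eqP Ufree) => er.
have : (\rank (bounds Id i.+1 d.+1 + U)%MS <= \rank (cycles Id i.+1 d.+1))%N.
  by apply: mxrankS; rewrite addsmx_sub Ucyc (bounds_cycles _ _ hI hId).
by rewrite er; lia.
Qed.

End Betti.

(** * Exactness of the Koszul complex and mapping cones *)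

Section Exact.
Variables (K : fieldType) (N : nat).
Notation S := {mpoly K[N]}.
Notation zz := (@zv K N).
Implicit Types (p q : S) (m : 'X_{1..N}) (w : {set 'I_N} -> S) (A B : {set 'I_N}).

Definition vanish_below m (b : nat) := [forall l : 'I_N, (l < b)%N ==> (m l == 0%N)].

(** Keeps the terms whose variable of least index is z_k and divides them by z_k. Multiplying back
    by z_k and summing over k recovers all but the constant term. *)
Definition divX (k : 'I_N) p : S :=
  \sum_(m : 'X_{1..N < msize p}) (if vanish_below m k then p@_(m + U_(k))%MM else 0) *: 'X_[m].

Lemma DvE k p m : (divX k p)@_m = if vanish_below m k then p@_(m + U_(k))%MM else 0.
Proof.
rewrite /divX; have [h|h] := ltnP (mdeg m) (msize p).
  by rewrite (mcoeff_mpoly (fun m => if vanish_below m k then p@_(m + U_(k))%MM else 0)).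
rewrite raddf_sum /= big1.
  case: ifP => // _; apply/esym/memN_msupp_eq0/msize_mdeg_ge.
  by rewrite mdegD mdeg1; lia.
move=> m' _; rewrite mcoeffZ mcoeffX; case: eqP => [e|]; last by rewrite mulr0.
by have := bmdeg m'; rewrite e ltnNge h.
Qed.

Lemma Dv0 k : divX k 0 = 0.
Proof. by apply/mpolyP => m; rewrite DvE !mcoeff0 if_same. Qed.

Lemma DvD k p q : divX k (p + q) = divX k p + divX k q.
Proof. by apply/mpolyP => m; rewrite mcoeffD !DvE; case: ifP; rewrite ?mcoeffD ?addr0. Qed.

Lemma DvN k p : divX k (- p) = - divX k p.
Proof. by apply/mpolyP => m; rewrite mcoeffN !DvE; case: ifP; rewrite ?mcoeffN ?oppr0. Qed.

Lemma divX_sum k (T : Type) (r : seq T) (P : pred T) (F : T -> S) :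
  divX k (\sum_(i <- r | P i) F i) = \sum_(i <- r | P i) divX k (F i).
Proof. exact: (big_morph (divX k) (DvD k) (Dv0 k)). Qed.

Lemma divX_esgn k l B p : divX k (esgn S l B * p) = esgn S l B * divX k p.
Proof. by rewrite /esgn -signr_odd !mulr_sign; case: odd; rewrite ?DvN. Qed.

Lemma divX_X_lt (b k : 'I_N) p : (k < b)%N -> divX b (zv K k * p) = 0.
Proof.
move=> kb; apply/mpolyP => m; rewrite DvE mcoeff0; case: ifP => // /forallP/(_ k).
rewrite kb /= => /eqP mk; rewrite mcoeff_XM lep1mP mnmDE mk mnm1E.
by rewrite [b == k](_ : _ = false) // -val_eqE; apply: gtn_eqF.
Qed.

Lemma divX_X_gt (b k : 'I_N) p : (b < k)%N -> divX b (zv K k * p) = zv K k * divX b p.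
Proof.
move=> bk; apply/mpolyP => m; rewrite DvE !mcoeff_XM DvE !lep1mP mnmDE mnm1E.
have bk' : (b == k) = false by rewrite -val_eqE; apply: ltn_eqF.
rewrite bk' addn0; have -> : vanish_below (m - U_(k))%MM b = vanish_below m b.
  apply: eq_forallb => l; rewrite mnmBE mnm1E; case: ltnP => //= lb.
  by rewrite (_ : (k == l) = false) ?subn0 // -val_eqE; apply: gtn_eqF; apply: ltn_trans lb bk.
case: ifP => h1; last by case: ifP.
case: ifP => // h2; congr (_@__); apply/mnmP => l; rewrite !(mnmBE, mnmDE, mnm1E).
by case: (eqVneq k l) => [<-|]; rewrite ?bk' ?addn0 ?subn0.
Qed.

Lemma divX_coeff_sum (b : nat) p m :
  (\sum_(k < N | (k < b)%N) zv K k * divX k p)@_m = if vanish_below m b then 0 else p@_m.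
Proof.
rewrite raddf_sum /=.
have E (k : 'I_N) : (zv K k * divX k p)@_m = if (m k != 0%N) && vanish_below m k then p@_m else 0.
  rewrite mcoeff_XM lep1mP; case: ifP => //= mk; rewrite DvE submK ?lep1mP //.
  congr (if _ then _ else _); apply: eq_forallb => l; rewrite mnmBE mnm1E.
  by case: ltnP => //= lb; rewrite (_ : (k == l) = false) ?subn0 // -val_eqE; apply: gtn_eqF.
under eq_bigr => k _ do rewrite E.
case: ifP => h.
  apply: big1 => k kb; case: ifP => // /andP[mk _]; move/forallP/(_ k): h.
  by rewrite kb (negbTE mk).
have [k0 /andP[k0b mk0] k0min] : exists2 k0 : 'I_N, (k0 < b)%N && (m k0 != 0%N) &
    forall l : 'I_N, (l < b)%N && (m l != 0%N) -> (k0 <= l)%N.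
  move/negbT: h; rewrite negb_forall => /existsP[l0]; rewrite negb_imply => hl0.
  by case: (@arg_minnP _ l0 (fun l : 'I_N => (l < b)%N && (m l != 0%N)) val hl0) => k0 h1 h2; exists k0.
have vk0 : vanish_below m k0.
  apply/forallP => l; apply/implyP => lk; apply: contraLR lk => ml; rewrite -leqNgt.
  case: (ltnP l b) => lb; first by apply: k0min; rewrite lb ml.
  by apply: leq_trans lb; apply: ltnW.
rewrite (bigD1 k0) //= mk0 vk0 big1 ?addr0 // => k /andP[kb ne]; case: ifP => // /andP[mk vk].
case/negP: ne; rewrite -val_eqE eqn_leq k0min ?kb // andbT leqNgt; apply/negP => lt.
by move/forallP/(_ k0): vk; rewrite lt (negbTE mk0).
Qed.

(** The homotopy built from partial derivatives yields multiplication by the degree, which may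
    vanish in K. This one moves the least variable of a monomial into the exterior factor whenever
    its index lies below the whole set; being the least, it brings no sign. *)
Definition koszul_htpy w A : S :=
  if [pick a in A | [forall l in A, (a <= l)%N]] is Some a then divX a (w (A :\ a)) else 0.

Lemma koszul_htpyE w A a : a \in A -> (forall l, l \in A -> (a <= l)%N) -> koszul_htpy w A = divX a (w (A :\ a)).
Proof.
move=> aA amin; rewrite /koszul_htpy; case: pickP => [a' /andP[a'A /forall_inP h]|/(_ a)].
  suff -> : a' = a by [].
  by apply/val_inj/eqP; rewrite eqn_leq h //= amin.
by rewrite aA /=; move/negbT/negP; case; apply/forall_inP.
Qed.

Lemma koszul_htpy_set0 w : koszul_htpy w set0 = 0.
Proof. by rewrite /koszul_htpy; case: pickP => // a; rewrite inE. Qed.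

Lemma esgn_below R (k : 'I_N) B : (forall l, l \in B -> (k <= l)%N) -> esgn R k B = 1.
Proof.
move=> h; rewrite /esgn (_ : [set l in B | (l < k)%N] = set0) ?cards0 //.
by apply/setP => l; rewrite !inE; apply/negP => /andP[/h]; rewrite leqNgt => /negP.
Qed.

(** Let b be the least element of B. The terms k < b of the first summand give the part of w(B) that
    involves a variable below z_b, the terms k > b of the two summands cancel, and the term k = b of
    the second gives the rest. On the empty set only the constant term cannot be recovered. *)
Lemma homotopy w B : (w set0)@_0%MM = 0 -> bd zz (koszul_htpy w) B + koszul_htpy (bd zz w) B = w B.
Proof.
move=> w0; have [->|/set0Pn[b0 hb0]] := eqVneq B set0.
  rewrite koszul_htpy_set0 addr0 /bd.
  apply/mpolyP => m; have := divX_coeff_sum N (w set0) m.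
  rewrite (eq_bigl (fun k : 'I_N => k \notin set0)); last by move=> k; rewrite inE ltn_ord.
  rewrite (eq_bigr (fun k => esgn S k set0 * zv K k * koszul_htpy w (k |: set0))); last first.
    move=> k _; rewrite esgn_below ?mul1r; last by move=> l; rewrite inE.
    rewrite (@koszul_htpyE w _ k) ?setU11 ?setU1K ?inE // => l; rewrite !inE orbF => /eqP->; exact: leqnn.
  move=> ->; case: ifP => // /forallP h; rewrite (_ : m = 0%MM) ?w0 //.
  by apply/mnmP => l; rewrite mnm0E; apply/eqP; move: (h l); rewrite ltn_ord.
have [b bB bmin] : exists2 b, b \in B & forall l, l \in B -> (b <= l)%N.
  by case: (@arg_minnP _ b0 (fun l : 'I_N => l \in B) val hb0) => b h1 h2; exists b.
rewrite (koszul_htpyE (bd zz w) bB bmin) /bd divX_sum.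
rewrite (bigID (fun k : 'I_N => (k < b)%N)) /=.
have -> : \sum_(i < N | (i \notin B) && (i < b)%N) esgn S i B * zv K i * koszul_htpy w (i |: B)
   = \sum_(k < N | (k < b)%N) zv K k * divX k (w B).
  apply: eq_big => k.
    by case: ltnP => kb; rewrite ?andbF ?andbT //; apply/negP => /bmin; rewrite leqNgt kb.
  move=> /andP[kB kb]; rewrite esgn_below ?mul1r; last first.
    by move=> l /bmin; apply/leq_trans/ltnW.
  rewrite (@koszul_htpyE w _ k) ?setU11 ?setU1K // => l; rewrite !inE => /orP[/eqP->//|/bmin].
  by apply/leq_trans/ltnW.
rewrite [X in _ + X](bigD1 b) ?setD11 //= setD1K //.
rewrite esgn_below ?mul1r; last by move=> l /setD1P[_ /bmin].
have -> : \sum_(i < N | (i \notin B :\ b) && (i != b)) divX b (esgn S i (B :\ b) * zv K i * w (i |: B :\ b))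
   = - \sum_(i < N | (i \notin B) && ~~ (i < b)%N) esgn S i B * zv K i * koszul_htpy w (i |: B).
  rewrite -sumrN (bigID (fun k : 'I_N => (k < b)%N)) /= big1 ?add0r.
    apply: eq_big => k.
      by rewrite !inE negb_and negbK; case: eqVneq => [->|_] /=; rewrite ?bB ?andbT.
    rewrite !inE -leqNgt => /andP[/andP[_ kb] bk].
    have {bk} bk : (b < k)%N by rewrite ltn_neqAle bk eq_sym andbT.
    rewrite (@koszul_htpyE w _ b) ?inE ?bB ?orbT //; last first.
      by move=> l /setU1P[->|/bmin//]; apply: ltnW.
    rewrite (esgnD1 _ _ bB) bk expr1 -!mulrA divX_esgn divX_X_gt // !mulN1r opprK.
    congr (_ * (_ * divX _ (w _))); apply/setP => x; rewrite !inE.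
    by case: (eqVneq x k) => [->|]; rewrite ?kb.
  by move=> k /andP[_ kb]; rewrite -mulrA divX_esgn divX_X_lt ?mulr0.
apply/mpolyP => m.
set s1 := \sum_(k < N | (k < b)%N) _; set s2 := \sum_(i < N | _) _.
rewrite [X in X@_m](_ : _ = s1 + divX b (zv K b * w B)); last by ring.
rewrite mcoeffD divX_coeff_sum DvE; case: ifP; rewrite ?addr0 // add0r.
by rewrite mcoeff_XM lem_addl addmK.
Qed.

Lemma divX_homog k d p : p \is d.+1.-homog -> divX k p \is d.-homog.
Proof.
move=> /dhomogP hp; apply/dhomogP => m; rewrite mcoeff_msupp DvE.
case: ifP => _; last by rewrite eqxx.
by rewrite -mcoeff_msupp => /hp; rewrite /= mdegD mdeg1; lia.
Qed.

Lemma is_chain_htpy i d w : is_chain i d.+1 w -> is_chain i.+1 d (koszul_htpy w).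
Proof.
move=> h A; rewrite /koszul_htpy; case: pickP => [a /andP[aA _]|_]; last by rewrite rpred0.
split; first by apply: divX_homog; case: (h (A :\ a)).
move=> c; have [_ ->] := h (A :\ a); rewrite ?Dv0 //; apply: contra c.
by rewrite (cardsD1 a A) aA add1n => /eqP->.
Qed.

Lemma bd_exact i d w : is_chain i d.+1 w -> (forall A, bd zz w A = 0) ->
  exists2 t, is_chain i.+1 d t & forall A, w A = bd zz t A.
Proof.
move=> hw cyc; exists (koszul_htpy w); first exact: is_chain_htpy.
move=> A; rewrite -[LHS]homotopy; last first.
  by apply: (dhomog_coeff (is_chain_homog set0 hw)); rewrite mdeg0.
rewrite [X in _ + X](_ : _ = 0) ?addr0 // /koszul_htpy.
by case: pickP => // a _; rewrite cyc Dv0.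
Qed.

End Exact.

(** * Vanishing above the line j = 2i *)

Section Good.
Variables (K : fieldType) (N : nat).
Notation S := {mpoly K[N]}.
Notation zz := (@zv K N).
Implicit Types (p q f : S) (I J : S -> Prop).

(** With j = i + d + 1 the condition i <= d says j > 2i. *)
Definition good I := forall i d, (i <= d)%N -> tor_vanish I i d.

Definition homI I := forall d p, I p -> I (pihomog mdeg d p).

Lemma tor_vanish_i0 I d : idealP I -> tor_vanish I 0 d.
Proof.
move=> [I0 _ _] w hw _; have [|t ht e] := bd_exact hw; first by move=> A; apply: is_chain_bd0 hw.
by exists t => // A; rewrite e subrr.
Qed.

Lemma good_zero I : (forall p, I p -> p = 0) -> I 0 -> good I.
Proof.
move=> h I0 i d _ w hw cyc; have [|t ht e] := bd_exact hw; first by move=> A; apply/h/cyc.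
by exists t => // A; rewrite e subrr.
Qed.

Lemma eq_good I J : (forall p, I p <-> J p) -> good I -> good J.
Proof.
move=> e h i d id w hw cyc; have [|t ht hwt] := h i d id w hw; first by move=> A; apply/e.
by exists t => // A; apply/e.
Qed.

Lemma bd_ideal I w B : idealP I -> (forall A, I (w A)) -> I (bd zz w B).
Proof.
by move=> hI h; apply: ideal_sum => // k _; case: hI => _ _; apply.
Qed.

(* Mapping cone of the short exact sequence 0 -> S/(I:f)(-e) -> S/I -> S/(I+f) -> 0. *)
Lemma good_step I f e J : idealP I -> homI I -> f \is e.-homog -> (0 < e <= 2)%N ->
  good I -> good (colon I f) -> (forall p, J p <-> exists u v, I u /\ p = u + v * f) -> good J.
Proof.
move=> hI hh hf he gI gC hJ i d id w hw cyc; have [I0 ID IM] := hI.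
have [i0|ipos] := posnP i.
  subst i; have [|t ht hwt] := @tor_vanish_i0 I d hI w hw; first by move=> A; rewrite (is_chain_bd0 A hw).
  by exists t => // A; apply/hJ; exists (w A - bd zz t A), 0; rewrite mul0r addr0.
case: i ipos id hw => // i _ id hw.
(* Dividing the values of the differential, of degree d + 2, by f leaves degree d' + 1; since e <=
   2, the inequality for (i + 1, d) passes to (i, d'). *)
have [d' dE] : exists d', d.+2 = (d'.+1 + e)%N by exists (d.+1 - e)%N; lia.
have id' : (i <= d')%N by lia.
pose v0 B := epsilon (inhabits (0 : S)) (fun v => I (bd zz w B - v * f)).
have v0P B : I (bd zz w B - v0 B * f).
  apply: (epsilon_spec (inhabits (0 : S)) (fun v => I (bd zz w B - v * f))).
  by have /hJ[u [v [hu ->]]] := cyc B; exists v; rewrite addrK.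
(* The arbitrary quotients are cut down to the right degree and to sets of size i, which makes them
   a chain. *)
pose v (B : {set 'I_N}) := if #|B| == i then pihomog mdeg d'.+1 (v0 B) else 0.
have hv : is_chain i d'.+1 v.
  move=> B; rewrite /v; case: ifP => _; last by rewrite rpred0.
  by split=> //; apply: pihomogP.
have vP B : I (bd zz w B - v B * f).
  have [h1 h2] := is_chain_bd hw B; rewrite /v; case: ifP => cB; last first.
    by rewrite h2 ?cB // mul0r subr0.
  have := hh d.+2 _ (v0P B).
  by rewrite linearB /= pihomog_dE // {1}dE pihomogZM.
have vcyc B : colon I f (bd zz v B).
  rewrite /colon.
  have -> : bd zz v B * f = - bd zz (fun B => bd zz w B - f * v B) B.
    by rewrite bdB bd_sq bdZ sub0r opprK mulrC.
  by apply: idealN => //; apply: bd_ideal => // A; rewrite [f * _]mulrC.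
have [t ht hvt] := gC i d' id' v hv vcyc.
(* Subtracting f times the bounding chain of [v] turns a cycle modulo I + (f) into a cycle modulo
   I. *)
pose w2 A := w A - f * t A.
have hw2 : is_chain i.+1 d.+1 w2.
  apply: iscB => //; have -> : d.+1 = (e + d')%N by lia.
  exact: iscM.
have [|s hs hws] := gI i.+1 d id w2 hw2.
  move=> B; rewrite /w2 bdB bdZ.
  have -> : bd zz w B - f * bd zz t B =
    (bd zz w B - v B * f) + (v B - bd zz t B) * f by ring.
  by apply: ID => //; apply: hvt.
exists s => // A; apply/hJ; exists (w2 A - bd zz s A), (t A); split=> //.
by rewrite /w2; ring.
Qed.

Inductive igen (P : S -> Prop) : S -> Prop :=
| igen0 : igen P 0
| igenS a g p : P g -> igen P p -> igen P (a * g + p).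

Lemma igen_ideal P : idealP (igen P).
Proof.
split; first exact: igen0.
  by move=> p q; elim=> [|a g p' hg _ IH] hq; rewrite ?add0r // -addrA; apply: igenS => //; apply: IH.
move=> a p; elim=> [|b g p' hg _ IH]; first by rewrite mulr0; apply: igen0.
by rewrite mulrDr mulrA; apply: igenS.
Qed.

Lemma igen_gen (P : S -> Prop) g : P g -> igen P g.
Proof. by move=> h; have := igenS 1 h (igen0 P); rewrite mul1r addr0. Qed.

Lemma igen_sub (P J : S -> Prop) p : idealP J -> (forall g, P g -> J g) -> igen P p -> J p.
Proof. by case=> J0 JD JM h; elim=> // a g q hg _ hq; apply: JD => //; apply: JM; apply: h. Qed.

Lemma colon_ideal I f : idealP I -> idealP (colon I f).
Proof.
case=> I0 ID IM; rewrite /colon; split; first by rewrite mul0r.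
  by move=> p q hp hq; rewrite mulrDl; apply: ID.
by move=> a p hp; rewrite -mulrA; apply: IM.
Qed.

Lemma igen_homI (P : S -> Prop) : (forall g, P g -> exists e, g \is e.-homog) -> homI (igen P).
Proof.
move=> h d p; have [I0 ID IM] := igen_ideal P.
elim=> [|a g q hg _ IH]; first by rewrite linear0.
rewrite linearD /=; apply: ID => //; have [e he] := h g hg.
have [de|ed] := ltnP d e; first by rewrite (pihomogZM_lt _ he de).
by rewrite -(subnK ed) (pihomogZM _ _ he); apply/IM/igen_gen.
Qed.

Lemma igen_add (P Q : S -> Prop) f p : (forall g, Q g <-> P g \/ g = f) ->
  igen Q p <-> exists u v, igen P u /\ p = u + v * f.
Proof.
move=> hQ; have [I0 ID IM] := igen_ideal P; have [J0 JD JM] := igen_ideal Q; split.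
  elim=> [|a g q /hQ[hg|->] _ [u [v [hu ->]]]].
  - by exists 0, 0; rewrite mul0r addr0.
  - by exists (a * g + u), v; split; [apply: ID => //; apply/IM/igen_gen | rewrite addrA].
  - by exists u, (a + v); split => //; ring.
case=> u [v [hu ->]]; apply: JD; last by apply/JM/igen_gen/hQ; right.
by apply: (igen_sub (igen_ideal Q) _ hu) => g hg; apply/igen_gen/hQ; left.
Qed.

End Good.

(** * Linear syzygies of parity binomials *)

Section Edges.
Variables (K : fieldType) (n : nat).
Notation S := {mpoly K[n + n]}.
Notation E := ('I_n * 'I_n)%type.
Notation zz := (@zv K (n + n)).
Implicit Types (G : rel 'I_n) (e : E) (r : E -> S) (A B : {set 'I_(n + n)}).

Definition gb e : S := gbar K e.1 e.2.
Definition is_edge G e := (val e.1 < val e.2)%N && G e.1 e.2.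

Lemma gbarC (a b : 'I_n) : gbar K a b = gbar K b a.
Proof. by rewrite /gbar mulrC [yv _ _ * _]mulrC. Qed.

Lemma gb_homog e : gb e \is 2.-homog.
Proof. by apply: rpredB; apply: (@dhomogM _ _ mdeg 1 _ 1); apply: dhomogX1. Qed.

Lemma parityP G p : parity_ideal (K := K) G p <-> exists r, p = \sum_(e | is_edge G e) r e * gb e.
Proof.
have sumE r : \sum_(e | is_edge G e) r e * gb e = \sum_(e <- edges G) r e * gb e.
  by rewrite /edges big_filter big_enum_cond.
have nthE x0 (k : 'I_(size (edges G))) : [seq gbar K p.1 p.2 | p <- edges G]`_k = gb (nth x0 (edges G) k).
  by rewrite (nth_map x0).
split=> [[rs []]|[r ->]].
  rewrite size_map => srs ->.
  exists (fun e => rs`_(index e (edges G))); rewrite sumE.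
  have us : uniq (edges G) by rewrite filter_uniq // enum_uniq.
  case: (edges G) us nthE => [|x0 s] us nthE.
    by rewrite big_ord0 big_nil.
  rewrite (big_nth x0) big_mkord; apply: eq_bigr => k _.
  by rewrite (nthE x0) index_uniq.
exists [seq r e | e <- edges G]; rewrite !size_map; split=> //; rewrite sumE.
case: (edges G) nthE => [|x0 s] nthE; first by rewrite big_ord0 big_nil.
rewrite (big_nth x0) big_mkord; apply: eq_bigr => k _.
by rewrite (nthE x0) (nth_map x0).
Qed.

Lemma parity_ideal_is_ideal G : idealP (parity_ideal (K := K) G).
Proof.
split.
- by apply/parityP; exists (fun=> 0); rewrite big1 // => e _; rewrite mul0r.
- move=> p q /parityP[r ->] /parityP[s ->]; apply/parityP; exists (fun e => r e + s e).
  by rewrite -big_split; apply: eq_bigr => e _; rewrite /= mulrDl.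
- move=> a p /parityP[r ->]; apply/parityP; exists (fun e => a * r e).
  by rewrite mulr_sumr; apply: eq_bigr => e _; rewrite mulrA.
Qed.

Lemma parity_homog G d p : p \is d.+2.-homog -> parity_ideal (K := K) G p ->
  exists2 r, (forall e, r e \is d.-homog) & p = \sum_(e | is_edge G e) r e * gb e.
Proof.
move=> hp /parityP[r e]; exists (fun e => pihomog mdeg d (r e)).
  by move=> e'; apply: pihomogP.
rewrite -[LHS](pihomog_dE hp) e raddf_sum /=; apply: eq_bigr => e' _.
by rewrite -addn2 (pihomogZM _ _ (gb_homog e')).
Qed.

Definition side (b : bool) (i : 'I_n) : 'I_(n + n) := if b then rshift n i else lshift n i.

Lemma sd_eq b b' i j : (side b i == side b' j) = (b == b') && (i == j).
Proof.
by case: b b' => [] []; rewrite /side ?eq_lshift ?eq_rshift ?eq_lrshift ?eq_rlshift.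
Qed.

Lemma sd_ex (z : 'I_(n + n)) : exists b i, z = side b i.
Proof. by rewrite -(splitK z); case: (split z) => i; [exists false, i | exists true, i]. Qed.

(* The monomial x_k y_i y_j (or y_k x_i x_j) arises from a single product of a
   variable and a binomial. *)
Lemma no_linear_syzygy r : (forall e, r e \is 1.-homog) ->
  \sum_(e : E | (val e.1 < val e.2)%N) r e * gb e = 0 ->
  forall e, (val e.1 < val e.2)%N -> r e = 0.
Proof.
move=> hr h e0 he0; apply/mpolyP => m; rewrite mcoeff0.
have [/eqP|ne] := eqVneq (mdeg m) 1%N; last exact: dhomog_coeff (hr e0) ne.
rewrite mdeg_eq1 => /existsP[z /eqP->] {m}; have [b [k ->]] := sd_ex z.
have nb : (~~ b == b) = false by case: (b).
pose Q e b : 'X_{1..n + n} := (U_(side b e.1) + U_(side b e.2))%MM.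
pose M := (Q e0 (~~ b) + U_(side b k))%MM.
have gbE e : gb e = (-1) ^+ b * ('X_[Q e b] - 'X_[Q e (~~ b)]).
  rewrite /gb /gbar /xv /yv /Q !mpolyXD /side; clear M nb; case: b => /=; ring.
have := congr1 (fun p : S => p@_M) h; rewrite mcoeff0 raddf_sum /= (bigD1 e0) //=.
have msign (bb : bool) (q : S) : ((-1) ^+ bb * q)@_M = (-1) ^+ bb * q@_M.
  by case: bb; rewrite ?expr0 ?expr1 ?mul1r ?mulN1r ?mcoeffN.
have Mb i : M (side b i) = (k == i).
  rewrite /M /Q !mnmDE !mnm1E !sd_eq eqxx.
  by rewrite nb.
have Mnb i : M (side (~~ b) i) = ((e0.1 == i) + (e0.2 == i))%N.
  rewrite /M /Q !mnmDE !mnm1E !sd_eq eqxx.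
  by rewrite [b == _]eq_sym nb addn0.
have le1 e : (val e.1 < val e.2)%N -> (Q e b <= M)%MM = false.
  move=> he; apply/negP => /mnm_lepP hle.
  have := hle (side b e.1); have := hle (side b e.2).
  rewrite !Mb /Q !mnmDE !mnm1E !eqxx; case: (eqVneq k e.1) => [->|]; last by lia.
  by case: (eqVneq e.1 e.2) => [e12|]; [rewrite e12 ltnn in he | lia].
rewrite big1 ?addr0.
  rewrite gbE mulrCA msign mulrBr mcoeffB ![r e0 * _]mulrC !mcoeff_XM le1 // sub0r.
  rewrite /M lem_addr addmC addmK => /eqP.
  by rewrite mulf_eq0 signr_eq0 oppr_eq0 => /eqP.
move=> e /andP[he ne]; rewrite gbE mulrCA msign mulrBr ![r e * _]mulrC.
have le2 : (Q e (~~ b) <= M)%MM = false.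
  apply/negP => /mnm_lepP hle.
  have := hle (side (~~ b) e.1); have := hle (side (~~ b) e.2).
  rewrite !Mnb /Q !mnmDE !mnm1E !eqxx; move: he ne he0.
  rewrite -pair_eqE /pair_eq -!val_eqE /=; lia.
by rewrite mcoeffB !mcoeff_XM le1 // le2 subrr mulr0.
Qed.

(** Multiplication by a variable turns a constant relation into a linear syzygy. *)
Lemma gb_free r : (forall e, r e \is 0.-homog) ->
  \sum_(e : E | (val e.1 < val e.2)%N) r e * gb e = 0 ->
  forall e, (val e.1 < val e.2)%N -> r e = 0.
Proof.
move=> hr h e he; pose z : S := 'X_(lshift n e.1).
have : r e * z = 0.
  apply: (@no_linear_syzygy (fun e => r e * z)) he => [e'|].
    by apply: (@dhomogM _ _ mdeg 0 _ 1) => //; apply: dhomogX1.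
  rewrite -[RHS](mulr0 z) -[X in _ = z * X]h mulr_sumr; apply: eq_bigr => e' _; by rewrite mulrA [z * _]mulrC. 
by move=> /eqP; rewrite mulf_eq0 => /orP[/eqP //|]; rewrite -msize_poly_eq0 msizeX.
Qed.

Lemma isE_sum G (f : E -> S) : \sum_(e | is_edge G e) f e =
  \sum_(e : E | (val e.1 < val e.2)%N) (if G e.1 e.2 then f e else 0).
Proof. by rewrite -big_mkcondr. Qed.

(** Write the differential of w as the sum of g_e ω_e with constant chains ω_e. A second
    differential gives a linear syzygy with coefficients the differentials of the ω_e, so these
    vanish. The ω_e have exterior degree at least 1, so they vanish too, and w is a cycle in S. For
    a 1-chain the ω_e would be free constants, which is what the exception i = 1 records. *)
Lemma tor_vanish_linear G i : tor_vanish (parity_ideal (K := K) G) i.+2 0.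
Proof.
move=> w hw cyc; have hI := parity_ideal_is_ideal G; have [I0 _ _] := hI.
have hb := is_chain_bd hw.
have hr A : exists r : E -> S, (forall e, r e \is 0.-homog) /\
    bd zz w A = \sum_(e : E | (val e.1 < val e.2)%N) r e * gb e.
  have [r h1 h2] := parity_homog (is_chain_homog A hb) (cyc A).
  exists (fun e => if G e.1 e.2 then r e else 0); split.
    by move=> e; case: ifP; rewrite ?rpred0.
  by rewrite h2 isE_sum; apply: eq_bigr => e _; case: ifP; rewrite ?mul0r.
pose rr A := epsilon (inhabits (fun=> 0)) (fun r : E -> S => (forall e, r e \is 0.-homog) /\
    bd zz w A = \sum_(e : E | (val e.1 < val e.2)%N) r e * gb e).
have rrP A : (forall e, rr A e \is 0.-homog) /\
    bd zz w A = \sum_(e : E | (val e.1 < val e.2)%N) rr A e * gb e.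
  exact: (epsilon_spec (inhabits (fun=> 0)) _ (hr A)).
pose om e A := if #|A| == i.+1 then rr A e else 0.
have hom_om e : is_chain i.+1 0 (om e).
  move=> A; rewrite /om; case: ifP => _; last by rewrite rpred0.
  by have [h1 _] := rrP A; split=> //; apply: h1.
have omE A : bd zz w A = \sum_(e : E | (val e.1 < val e.2)%N) gb e * om e A.
  case cA: (#|A| == i.+1).
    by have [_ ->] := rrP A; apply: eq_bigr => e _; rewrite /om cA mulrC.
  have [_ ->] := hb A; last by rewrite cA.
  by rewrite big1 // => e _; rewrite /om cA mulr0.
have om0 e : (val e.1 < val e.2)%N -> forall A, om e A = 0.
  move=> he; apply: bd_const0 (hom_om e) _ => A.
  apply: (@no_linear_syzygy (fun e => bd zz (om e) A)) he => [e'|].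
    exact: is_chain_homog (is_chain_bd (hom_om e')).
  rewrite -[RHS](bd_sq zz w A) (eq_bd zz omE) bd_sum; apply: eq_bigr => e' _.
  by rewrite bdZ mulrC.
have [|t ht e] := bd_exact hw.
  by move=> A; rewrite omE big1 // => e he; rewrite om0 ?mulr0.
by exists t => // A; rewrite e subrr.
Qed.

Lemma linear_strand G i : i <> 1%N -> betti (parity_ideal (K := K) G) i i.+1 = 0%N.
Proof.
move=> i1; have hI := parity_ideal_is_ideal G.
rewrite -addn1; apply: tor_vanish_betti => //.
case: i i1 => [|[|i]] // _; [exact: tor_vanish_i0 | exact: tor_vanish_linear].
Qed.

(** Membership of p g_ab in the ideal of the other edges is a linear syzygy in which g_ab has
    coefficient -p. *)
Lemma colon_linear G a b p : simple_graph G -> G a b -> p \is 1.-homog ->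
  colon (parity_ideal (K := K) (delete_edge G a b)) (gbar K a b) p -> p = 0.
Proof.
move=> [Gs Gi].
wlog ab : a b / (val a < val b)%N => [wl|].
  move=> Gab hp h; have ne : val a != val b.
    by apply/eqP => /val_inj e; rewrite e Gi in Gab.
  case: (ltngtP (val a) (val b)) ne => // lt _; first exact: (wl a b).
  apply: (wl b a) => //; first by rewrite Gs.
  rewrite /colon gbarC in h *.
  have [r hr] := proj1 (parityP _ _) h; apply/parityP; exists r; rewrite hr.
  by apply: eq_bigl => e; rewrite /is_edge /delete_edge [[set b; a]]setUC.
move=> Gab hp h.
have hh : p * gbar K a b \is 3.-homog by apply: (@dhomogM _ _ mdeg 1 _ 2) => //; apply: (gb_homog (a, b)).
have [r hr e] := parity_homog hh h.
pose r2 (e : E) := if e == (a, b) then - p else if delete_edge G a b e.1 e.2 then r e else 0.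
suff : r2 (a, b) = 0 by rewrite /r2 eqxx => /eqP; rewrite oppr_eq0 => /eqP.
apply: no_linear_syzygy => //.
  by move=> e'; rewrite /r2; case: ifP => _; [rewrite rpredN | case: ifP; rewrite ?rpred0].
rewrite (bigD1 (a, b)) //= {1}/r2 eqxx mulNr /gb /= e isE_sum (bigD1 (a, b)) //=.
rewrite /delete_edge eqxx andbF add0r; apply/eqP; rewrite addrC subr_eq0; apply/eqP.
apply: eq_bigr => e' /andP[_ ne]; rewrite /r2 (negbTE ne) /delete_edge.
by case: ifP; rewrite ?mul0r.
Qed.

Lemma colon_diag G a b i : simple_graph G -> G a b -> (0 < i)%N ->
  betti (colon (parity_ideal (K := K) (delete_edge G a b)) (gbar K a b)) i i = 0%N.
Proof.
move=> hG Gab; case: i => // i _; apply: betti_ii.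
  exact/colon_ideal/parity_ideal_is_ideal.
by move=> p; apply: colon_linear hG Gab.
Qed.

(* [wedge e] is the exterior product with a 1-chain whose boundary is [gb e]. *)
Definition wedge e := wdg (xv K e.1, yv K e.1, (lshift n e.2, rshift n e.2)).
Notation one := (@unit_chain S (n + n)).

Lemma bd_wedge e w B : bd zz (wedge e w) B = gb e * w B - wedge e (bd zz w) B.
Proof. exact: bd_wdg. Qed.

Lemma is_chain_one : is_chain 0 0 one.
Proof.
move=> A; rewrite /unit_chain; split; first by case: ifP; rewrite ?rpred0 // dhomog1.
by rewrite cards_eq0 => /negbTE->.
Qed.

Lemma is_chain_ext i d k w : is_chain i d w -> is_chain i.+1 d (@ext {mpoly K[n + n]} (n + n) k w).
Proof.
move=> h A; rewrite /ext; case: ifP => kA; last by rewrite rpred0.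
have [h1 h2] := h (A :\ k); split.
  by rewrite /esgn -signr_odd mulr_sign; case: odd; rewrite ?rpredN.
by rewrite (cardsD1 k) kA add1n eqSS => /h2->; rewrite mulr0.
Qed.

Lemma is_chain_wedge i d e w : is_chain i d w -> is_chain i.+1 d.+1 (wedge e w).
Proof.
move=> h; rewrite -add1n.
by apply: (iscB (w1 := fun A => xv K e.1 * ext (lshift n e.2) w A)
  (w2 := fun A => yv K e.1 * ext (rshift n e.2) w A)); apply: (@iscM K (n + n) _ _ 1);
  first [exact: dhomogX1 | exact: is_chain_ext].
Qed.

Lemma bd_wedge1 e B : bd zz (wedge e one) B = gb e * one B.
Proof. exact: bd_wdg1. Qed.

Lemma card_ltn_pairs m : #|[pred x : 'I_m * 'I_m | (val x.1 < val x.2)%N]| = 'C(m, 2).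
Proof.
rewrite -sum1_card -(pair_big_dep xpredT (fun i j : 'I_m => (val i < val j)%N) (fun _ _ => 1%N)) /=.
rewrite (exchange_big_dep xpredT) //= -triangular_sum big_mkord; apply: eq_bigr => j _.
by rewrite (big_ord_narrow (ltnW (ltn_ord j))) sum1_card card_ord.
Qed.

Lemma parity_gb G e : is_edge G e -> parity_ideal (K := K) G (gb e).
Proof.
move=> he; apply/parityP; exists (fun e' => if e' == e then 1 else 0).
rewrite (bigD1 e) //= eqxx mul1r big1 ?addr0 // => e' /andP[_ ne].
by rewrite (negbTE ne) mul0r.
Qed.

Lemma parity_gbar G a b : simple_graph G -> G a b -> parity_ideal (K := K) G (gbar K a b).
Proof.
move=> [Gs Gi] Gab; have ne : val a != val b.
  by apply/eqP => /val_inj e; rewrite e Gi in Gab.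
case: (ltngtP (val a) (val b)) ne => // lt _.
  by apply: (@parity_gb _ (a, b)); rewrite /is_edge lt.
by rewrite gbarC; apply: (@parity_gb _ (b, a)); rewrite /is_edge lt /= Gs.
Qed.

(** The classes are the products c_k c_l for k < l. A combination that bounds modulo the ideal
    equals a boundary plus a sum of g_e ω_e with constant chains ω_e; two successive differentials
    reduce this to a linear and then to a constant relation among the g_e. *)
Lemma koszul_syzygies G : ('C(nedges G, 2) <= betti (parity_ideal (K := K) G) 2 4)%N.
Proof.
have hI := parity_ideal_is_ideal G; have [I0 ID IM] := hI.
pose m := nedges G.
pose ed (k : 'I_m) : E := tnth (in_tuple (edges G)) k.
have edE k : is_edge G (ed k).
  have : ed k \in edges G by apply: mem_tnth.
  by rewrite mem_filter => /andP[].
have edlt k : (val (ed k).1 < val (ed k).2)%N by case/andP: (edE k).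
have ed_inj : injective ed.
  by apply/tuple_uniqP; rewrite /= /edges filter_uniq // enum_uniq.
pose T := {x : 'I_m * 'I_m | (val x.1 < val x.2)%N}.
have <- : #|{: T}| = 'C(m, 2) by rewrite card_sig card_ltn_pairs.
pose u (x : T) := wedge (ed (val x).1) (wedge (ed (val x).2) one).
have bdu x B : bd zz (u x) B = gb (ed (val x).1) * wedge (ed (val x).2) one B
    - gb (ed (val x).2) * wedge (ed (val x).1) one B.
  exact: bd_wdg2.
apply: (@betti_lower _ _ _ 1 1 _ u) => //.
- by move=> x; do 2!apply: is_chain_wedge; apply: is_chain_one.
- move=> x A; rewrite bdu mulrC [X in _ - X]mulrC.
  by apply: idealB => //; apply: IM; apply: parity_gb.
move=> cc th hth hin.
pose eta A := \sum_t cc t *: u t A - bd zz th A.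
have heta : is_chain 2 2 eta.
  apply: iscB; last exact: is_chain_bd.
  move=> A; split; last first.
    move=> cA; apply: big1 => t _; rewrite /u; have [_ ->] := is_chain_wedge (ed (val t).1) (is_chain_wedge (ed (val t).2) is_chain_one) A => //.
    by rewrite scaler0.
  apply: rpred_sum => t _; rewrite dhomogZ //.
  by apply: is_chain_homog (is_chain_wedge _ (is_chain_wedge _ is_chain_one)).
have hr A : exists r : E -> S, (forall e, r e \is 0.-homog) /\
    eta A = \sum_(e : E | (val e.1 < val e.2)%N) r e * gb e.
  have [r h1 h2] := parity_homog (is_chain_homog A heta) (hin A).
  exists (fun e => if G e.1 e.2 then r e else 0); split.
    by move=> e; case: ifP; rewrite ?rpred0.
  by rewrite h2 isE_sum; apply: eq_bigr => e _; case: ifP; rewrite ?mul0r.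
pose rr A := epsilon (inhabits (fun=> 0)) (fun r : E -> S => (forall e, r e \is 0.-homog) /\
    eta A = \sum_(e : E | (val e.1 < val e.2)%N) r e * gb e).
have rrP A : (forall e, rr A e \is 0.-homog) /\
    eta A = \sum_(e : E | (val e.1 < val e.2)%N) rr A e * gb e.
  exact: (epsilon_spec (inhabits (fun=> 0)) _ (hr A)).
pose om e A := if #|A| == 2 then rr A e else 0.
have hom_om e : is_chain 2 0 (om e).
  move=> A; rewrite /om; case: ifP => _; last by rewrite rpred0.
  by have [h1 _] := rrP A; split=> //; apply: h1.
have omE A : eta A = \sum_(e : E | (val e.1 < val e.2)%N) gb e * om e A.
  case cA: (#|A| == 2).
    by have [_ ->] := rrP A; apply: eq_bigr => e _; rewrite /om cA mulrC.
  have [_ ->] := heta A; last by rewrite cA.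
  by rewrite big1 // => e _; rewrite /om cA mulr0.
(* The coefficient of g_e in the differential of the combination. By the absence of linear syzygies
   it equals the differential of [om e]. *)
pose st e B : S := \sum_(t : T) (cc t)%:MP * ((ed (val t).1 == e)%:R * wedge (ed (val t).2) one B
   - (ed (val t).2 == e)%:R * wedge (ed (val t).1) one B).
have bdeta B : bd zz eta B = \sum_(e : E | (val e.1 < val e.2)%N) st e B * gb e.
  rewrite /eta bdB bd_sq subr0 bd_sum.
  transitivity (\sum_(t : T) (cc t)%:MP * (gb (ed (val t).1) * wedge (ed (val t).2) one B
    - gb (ed (val t).2) * wedge (ed (val t).1) one B)).
    apply: eq_bigr => t _; rewrite -bdu -bdZ; apply: eq_bd => A.
    by rewrite mul_mpolyC.
  under [RHS]eq_bigr => e _ do rewrite /st mulr_suml.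
  rewrite exchange_big /=; apply: eq_bigr => t _.
  have sel k (a : S) : \sum_(e : E | (val e.1 < val e.2)%N) (ed k == e)%:R * (a * gb e) = gb (ed k) * a.
    rewrite (bigD1 (ed k) (edlt k)) eqxx mul1r big1.
      exact: etrans (addr0 _) (mulrC _ _).
    move=> e /andP[_ ne].
    by rewrite eq_sym (negbTE ne) mul0r.
  rewrite -!sel -sumrB mulr_sumr; apply: eq_bigr => e _.
  by rewrite -[RHS]mulrA; congr (_ * _); rewrite [RHS]mulrBl; congr (_ - _); rewrite mulrA.
have stE e B : (val e.1 < val e.2)%N -> st e B = bd zz (om e) B.
  move=> he; apply/eqP; rewrite -subr_eq0; apply/eqP.
  apply: (@no_linear_syzygy (fun e => st e B - bd zz (om e) B)) he => [e'|].
    apply: rpredB; last exact: is_chain_homog (is_chain_bd (hom_om e')).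
    apply: rpred_sum => t _; rewrite mul_mpolyC dhomogZ //.
    by rewrite !mulr_natl; apply: rpredB; apply: rpredMn; apply: is_chain_homog (is_chain_wedge _ is_chain_one).
  under eq_bigr => e' _ do rewrite mulrBl.
  rewrite sumrB -bdeta (eq_bd zz omE) bd_sum -sumrB; apply: big1 => e' _.
  by rewrite bdZ; ring.
move=> t0; have [k [l lt]] : exists k l, val t0 = (k, l) by case: (val t0) => k l; exists k, l.
(* Being a boundary, [st (ed k)] has zero differential. This is a constant relation among the g_e,
   and its coefficient at the second edge of [t0] is [cc t0]. *)
pose q e' : S := \sum_(t : T) (cc t)%:MP * ((ed (val t).1 == ed k)%:R * (ed (val t).2 == e')%:R
   - (ed (val t).2 == ed k)%:R * (ed (val t).1 == e')%:R).
have : q (ed l) = 0.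
  apply: gb_free (edlt l) => [e'|].
    apply: rpred_sum => t _; rewrite mul_mpolyC dhomogZ // -!natrM.
    by apply: rpredB; apply: rpredMn; apply: dhomog1.
  have := bd_sq zz (om (ed k)) set0.
  rewrite -(eq_bd zz (fun B => stE (ed k) B (edlt k))) => h.
  rewrite -[RHS]h /st bd_sum.
  under eq_bigr => e' _ do rewrite /q mulr_suml.
  rewrite exchange_big /=; apply: eq_bigr => t _.
  have lin (a1 a2 a3 : S) f1 f2 B : bd zz (fun A => a1 * (a2 * f1 A - a3 * f2 A)) B =
      a1 * (a2 * bd zz f1 B - a3 * bd zz f2 B) by rewrite bdZ bdB !bdZ.
  rewrite lin !bd_wedge1.
  have -> : one set0 = 1 by rewrite /unit_chain eqxx.
  rewrite !mulr1.
  have sel k' (a : S) : \sum_(e : E | (val e.1 < val e.2)%N) (ed k' == e)%:R * (a * gb e) = gb (ed k') * a.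
    rewrite (bigD1 (ed k') (edlt k')) eqxx mul1r big1.
      exact: etrans (addr0 _) (mulrC _ _).
    move=> e /andP[_ ne].
    by rewrite eq_sym (negbTE ne) mul0r.
  rewrite ![_%:R * gb _]mulrC -!sel -sumrB mulr_sumr; apply: eq_bigr => e' _.
  by rewrite -[LHS]mulrA; congr (_ * _); rewrite [LHS]mulrBl; congr (_ - _); rewrite -mulrA mulrCA.
rewrite /q (bigD1 t0) //= lt /= !eqxx mulr1 big1 ?addr0.
  have -> : (ed l == ed k) = false.
    apply/eqP => /ed_inj e; have := valP t0; by rewrite lt /= e ltnn.
  by rewrite mul0r subr0 mulr1 => /eqP; rewrite mpolyC_eq0 => /eqP.
move=> t ne; rewrite !(inj_eq ed_inj).
case: eqP => [e1|_]; case: eqP => [e2|_]; rewrite ?mul0r ?mulr0 ?subrr ?sub0r ?mulr0 //.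
all: first [by case/negP: ne; rewrite -val_eqE /= lt -pair_eqE /= e1 e2 !eqxx |
  case: eqP => [e3|_]; case: eqP => [e4|_]; rewrite ?mul0r ?mulr0 ?oppr0 ?mulr0 //;
  have := valP t; rewrite /= e3 e4; have := valP t0; rewrite lt /=; lia].
Qed.

End Edges.

(** * Detecting products of three cycles by a linear section *)

Section LinearSection.
Variables (K : fieldType) (n : nat).
Notation S := {mpoly K[n + n]}.
Notation R := {mpoly K[3]}.
Notation E := ('I_n * 'I_n)%type.
Notation zz := (@zv K (n + n)).
Implicit Types (G : rel 'I_n) (e : E) (A B : {set 'I_(n + n)}).

Lemma homog1E N (p : {mpoly K[N]}) : p \is 1.-homog -> p = \sum_i p@_U_(i) *: 'X_i.
Proof.
move=> hp; apply/mpolyP => m; rewrite raddf_sum /=.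
have [/eqP|ne] := eqVneq (mdeg m) 1%N.
  rewrite mdeg_eq1 => /existsP[j /eqP->]; rewrite (bigD1 j) //= mcoeffZ mcoeffX eqxx mulr1.
  by rewrite big1 ?addr0 // => i ne; rewrite mcoeffZ mcoeffX eq_mnm1 (negbTE ne) mulr0.
rewrite (dhomog_coeff hp ne) big1 // => i _; rewrite mcoeffZ mcoeffX.
by case: eqP => [e|]; [rewrite -e mdeg1 in ne | rewrite mulr0].
Qed.

Variables (pt : 'I_(n + n) -> R) (lam : {linear R -> K | *%R}).
Hypothesis pt_homog : forall z, pt z \is 1.-homog.

Definition section_map : S -> R := mmap (@mpolyC 3 K) pt.
HB.instance Definition _ := GRing.RMorphism.on section_map.

Lemma sectX z : section_map 'X_z = pt z.
Proof. by rewrite /section_map mmapX mmap1U. Qed.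

Lemma sectZ c p : section_map (c *: p) = c *: section_map p.
Proof. by rewrite -mul_mpolyC rmorphM /= [section_map _%:MP]mmapC mul_mpolyC. Qed.

Definition lin_coef (i : 'I_3) (z : 'I_(n + n)) : R := ((pt z)@_U_(i))%:MP.
(** The top component of a 3-chain under the map to a 3-dimensional space whose coordinates are the
    coefficients of the linear forms [pt z]. *)
Definition contr (w : {set 'I_(n + n)} -> R) : R :=
  bd (lin_coef 0) (bd (lin_coef 1) (bd (lin_coef 2%:R) w)) set0.

Lemma ord3_sum (V : nmodType) (f : 'I_3 -> V) : \sum_i f i = f 0 + f 1 + f 2%:R.
Proof.
rewrite !big_ord_recl big_ord0 addr0 addrA; congr (f _ + f _ + f _); exact/val_inj.
Qed.

Lemma section_bd w B : section_map (bd zz w B) =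
  'X_0 * bd (lin_coef 0) (section_map \o w) B + 'X_1 * bd (lin_coef 1) (section_map \o w) B + 'X_(2%:R) * bd (lin_coef 2%:R) (section_map \o w) B.
Proof.
rewrite -!bdaZ -!bdaD /bd rmorph_sum /=; apply: eq_bigr => k _.
rewrite !rmorphM /= sectX /esgn rmorphXn rmorphN1; congr (_ * _ * _).
rewrite [LHS](homog1E (pt_homog k)) ord3_sum /lin_coef.
by congr (_ + _ + _); rewrite mulrC mul_mpolyC.
Qed.

Lemma contr_bd w : contr (section_map \o bd zz w) = 0.
Proof.
by rewrite /contr (eq_bd _ (eq_bd _ (eq_bd _ (section_bd w)))) bd_triple.
Qed.

Lemma lam_bd i v B : (forall A, lam (v A) = 0) -> lam (bd (lin_coef i) v B) = 0.
Proof.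
move=> h; rewrite /bd linear_sum /= big1 // => k _.
rewrite /esgn -signr_odd mulr_sign /lin_coef; case: odd; rewrite ?mulNr mul_mpolyC ?linearN linearZ /= h mulr0 ?oppr0 //.
Qed.

Lemma contr_lam v : (forall A, lam (v A) = 0) -> lam (contr v) = 0.
Proof. by move=> h; do 3!apply: lam_bd => ?. Qed.

Lemma lam_ideal G p : (forall e j, is_edge G e -> lam ('X_j * section_map (gb K e)) = 0) ->
  p \is 3.-homog -> parity_ideal (K := K) G p -> lam (section_map p) = 0.
Proof.
move=> hG hp hin; have [r hr ->] := parity_homog hp hin.
rewrite rmorph_sum linear_sum /=; apply: big1 => e he; rewrite rmorphM /=.
rewrite [r e](homog1E (hr e)) rmorph_sum mulr_suml linear_sum /=; apply: big1 => z _.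
rewrite sectZ sectX -scalerAl linearZ /= (homog1E (pt_homog z)) mulr_suml linear_sum /=.
by rewrite big1 ?mulr0 // => j _; rewrite -scalerAl linearZ /= hG ?mulr0.
Qed.

Definition wimg e := (pt (lshift n e.1), pt (rshift n e.1), (lshift n e.2, rshift n e.2)).

Lemma section_wedge e w : section_map \o wedge e w =1 wdg (wimg e) (section_map \o w).
Proof.
move=> A; rewrite /= /wedge /wdg rmorphB !rmorphM /= !sectX /ext.
by congr (_ * _ - _ * _); case: ifP; rewrite ?rmorph0 // rmorphM /= /esgn rmorphXn rmorphN1.
Qed.

(** The determinant of the coefficients when the images of the three binomials are written as
    combinations of the three variables. For a regular sequence this determinant generates the socle
    of the quotient. *)
Definition det3 e1 e2 e3 : R := wdet (lin_coef 0) (lin_coef 1) (lin_coef 2%:R) (wimg e1) (wimg e2) (wimg e3).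

Lemma contr_wedge3 e1 e2 e3 :
  contr (section_map \o wedge e1 (wedge e2 (wedge e3 (@unit_chain S (n + n))))) = det3 e1 e2 e3.
Proof.
rewrite /det3 -bd_wdg3 /contr; apply: eq_bd => ?; apply: eq_bd => ?; apply: eq_bd => ?.
rewrite section_wedge; apply: eq_wdg => ?; rewrite section_wedge; apply: eq_wdg => ?.
rewrite section_wedge; apply: eq_wdg => ?.
by rewrite /= /unit_chain; case: ifP; rewrite ?rmorph1 ?rmorph0.
Qed.

(** Substitution, [contr] and [lam] compose to a functional that vanishes on boundaries by
    [contr_bd] and on chains with values in the ideal by [lam_ideal]. A nonzero value on the triple
    product is all that is needed; regularity of the three quadrics is never invoked. *)
Lemma betti36 G e1 e2 e3 : simple_graph G ->
  (forall e, e \in [:: e1; e2; e3] -> G e.1 e.2) ->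
  (forall e j, is_edge G e -> lam ('X_j * section_map (gb K e)) = 0) ->
  lam (det3 e1 e2 e3) != 0 -> betti (parity_ideal (K := K) G) 3 6 <> 0%N.
Proof.
move=> hG he hlam hdet.
have hI := parity_ideal_is_ideal K G; have [I0 ID IM] := hI.
have hg e : G e.1 e.2 -> parity_ideal (K := K) G (gb K e) by apply: parity_gbar.
have cyc e w : G e.1 e.2 -> (forall A, parity_ideal (K := K) G (bd zz w A)) ->
    forall A, parity_ideal (K := K) G (bd zz (wedge e w) A).
  move=> Ge h A; rewrite bd_wedge mulrC; apply: idealB => //; first exact/IM/hg.
  have hext k B : parity_ideal (K := K) G (ext k (bd zz w) B).
    by rewrite /ext; case: ifP => // _; apply: IM.
  by apply: idealB => //; apply: IM.
pose u (_ : unit) := wedge e1 (wedge e2 (wedge e3 (@unit_chain S (n + n)))).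
suff : (#|{: unit}| <= betti (parity_ideal (K := K) G) 3 6)%N by rewrite card_unit => h e; rewrite e in h.
have hu t : is_chain 3 3 (u t) by do 3!apply: is_chain_wedge; apply: is_chain_one.
apply: (@betti_lower _ _ _ 2 2 _ u) => //.
  move=> t; apply: (cyc e1); first by apply: he; rewrite !inE eqxx.
  apply: (cyc e2); first by apply: he; rewrite !inE eqxx orbT.
  apply: (cyc e3); first by apply: he; rewrite !inE eqxx !orbT.
  by move=> A; rewrite bd_unit_chain.
move=> c th hth hin [].
have E0 A : \sum_t c t *: u t A = c tt *: u tt A.
  by rewrite (bigD1 tt) //= big1 ?addr0 // => -[].
pose eta A := c tt *: u tt A - bd zz th A.
have heta A : lam (section_map (eta A)) = 0.
  apply: (lam_ideal hlam); last by rewrite /eta -E0.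
  apply: rpredB; first by rewrite dhomogZ //; case: (hu tt A).
  by have [] := is_chain_bd hth A.
have : lam (contr (section_map \o eta)) = 0 by apply: contr_lam.
have e1' B : (section_map \o eta) B = (c tt)%:MP * (section_map \o u tt) B - (section_map \o bd zz th) B.
  by rewrite /= /eta rmorphB /= sectZ mul_mpolyC.
rewrite /contr (eq_bd _ (eq_bd _ (eq_bd _ e1'))).
have lin i f1 f2 B : bd (lin_coef i) (fun B => (c tt)%:MP * f1 B - f2 B) B =
   (c tt)%:MP * bd (lin_coef i) f1 B - bd (lin_coef i) f2 B by rewrite bdB bdZ.
rewrite (eq_bd _ (eq_bd _ (lin _ _ _))) (eq_bd _ (lin _ _ _)) lin.
rewrite -!/(contr _) contr_bd subr0 contr_wedge3 mul_mpolyC linearZ /= => /eqP.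
by rewrite mulf_eq0 (negbTE hdet) orbF => /eqP.
Qed.

End LinearSection.

(** * Nonbipartite graphs *)

Local Notation o0 := (0%R : 'I_3).
Local Notation o1 := (1%R : 'I_3).
Local Notation o2 := (2%:R%R : 'I_3).

Section Ternary.
Variable K : fieldType.
Notation R := {mpoly K[3]}.

Definition mk (a b c : nat) : 'X_{1..3} := (U_(o0) *+ a + U_(o1) *+ b + U_(o2) *+ c)%MM.
Definition T a b c : R := 'X_[mk a b c].

Lemma mkE a b c : (mk a b c o0 = a) * (mk a b c o1 = b) * (mk a b c o2 = c).
Proof. by rewrite /mk !mnmDE !mulmnE !mnm1E /=; do !split; lia. Qed.

Lemma mk_eq a b c a' b' c' : (mk a b c == mk a' b' c') = [&& a == a', b == b' & c == c'].
Proof.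
apply/eqP/and3P => [e|[/eqP-> /eqP-> /eqP->]] //.
by have := mkE a b c; rewrite e !mkE => -[[-> ->] ->].
Qed.

Lemma TM a b c a' b' c' : T a b c * T a' b' c' = T (a + a') (b + b') (c + c').
Proof.
rewrite /T -mpolyXD; congr 'X_[_]; apply/mnmP => i.
rewrite /mk !mnmDE !mulmnE; lia.
Qed.

Lemma ordinal3 (j : 'I_3) : [\/ j = o0, j = o1 | j = o2].
Proof.
case: j => -[|[|[|//]]] h; [apply: Or31 | apply: Or32 | apply: Or33]; exact/val_inj.
Qed.

Lemma U3 : (U_(o0)%MM = mk 1 0 0) * (U_(o1)%MM = mk 0 1 0) * (U_(o2)%MM = mk 0 0 1).
Proof. by do !split; apply/mnmP => i; rewrite /mk !mnmDE !mulmnE; lia. Qed.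

Definition wcoef (s : seq (nat * nat * nat * K)) (q : R) : K :=
  \sum_(x <- s) x.2 * q@_(mk x.1.1.1 x.1.1.2 x.1.2).

Lemma wcoef_linear s : linear_for *%R (wcoef s).
Proof.
move=> c p q; rewrite /wcoef mulr_sumr -big_split; apply: eq_bigr => x _ /=.
by rewrite mcoeffD mcoeffZ mulrDr mulrCA.
Qed.
HB.instance Definition _ s := GRing.isLinear.Build K R K *%R (wcoef s) (wcoef_linear s).

Lemma wcoefT s a b c : wcoef s (T a b c) =
  \sum_(x <- s) (if [&& a == x.1.1.1, b == x.1.1.2 & c == x.1.2] then x.2 else 0).
Proof.
apply: eq_bigr => x _; rewrite /T mcoeffX mk_eq; case: ifP; by rewrite ?mulr1 ?mulr0.
Qed.

Lemma T_homog a b c d : (a + b + c)%N = d -> T a b c \is d.-homog.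
Proof.
move=> <-; rewrite /T dhomogX /= /mk !mdegD !mdegMn !mdeg1 !mul1n; exact/eqP.
Qed.

End Ternary.

Section Witness.
Variables (K : fieldType) (n : nat) (G : rel 'I_n).
Hypothesis hG : simple_graph G.
Notation R := {mpoly K[3]}.
Notation T := (T K).

Definition point_map (P : 'I_n -> R * R) (z : 'I_(n + n)) : R :=
  match split z with inl i => (P i).1 | inr i => (P i).2 end.

Lemma ptof_l P i : point_map P (lshift n i) = (P i).1.
Proof. by rewrite /point_map; have -> : split (lshift n i) = inl i :> 'I_n + 'I_n by exact: (unsplitK (inl i)). Qed.

Lemma ptof_r P i : point_map P (rshift n i) = (P i).2.
Proof. by rewrite /point_map; have -> : split (rshift n i) = inr i :> 'I_n + 'I_n by exact: (unsplitK (inr i)). Qed.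

Lemma section_gb P e : section_map (point_map P) (gb K e) = (P e.1).1 * (P e.2).1 - (P e.1).2 * (P e.2).2.
Proof.
by rewrite /gb /gbar rmorphB !rmorphM /= !sectX !ptof_l !ptof_r.
Qed.

Lemma XT (j : 'I_3) : [\/ 'X_j = T 1 0 0, 'X_j = T 0 1 0 | 'X_j = T 0 0 1].
Proof.
by case: (ordinal3 j) => ->; [apply: Or31 | apply: Or32 | apply: Or33]; rewrite /T U3.
Qed.

Local Ltac wcompute := rewrite ?(mulrBr, mulrDr, mulrDl, mulrBl, mulrN, mulNr, mul0r, mulr0, mul1r, mulr1, opprD, opprK, oppr0, addr0, add0r, subr0, sub0r) ?TM
  ?raddfB ?raddfD ?raddfN ?raddf0 /= ?raddfN /= ?wcoefT !unlock /= ?(addr0, add0r, subrr, subr0, sub0r, oppr0, addNr).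

(** The vertices go to (a, 0), (a, b), (c, b), (c, 0) and all others to (0, 0), so the path gives
    a^2, ac - b^2, c^2 and every edge leaving it gives 0. Each of the three missing pairs would give
    ac, which [lam] does not kill after multiplication by b; hence the path must be induced. *)
Lemma path_witness v1 v2 v3 v4 : uniq [:: v1; v2; v3; v4] ->
  G v1 v2 -> G v2 v3 -> G v3 v4 -> ~~ G v1 v3 -> ~~ G v2 v4 -> ~~ G v1 v4 ->
  betti (parity_ideal (K := K) G) 3 6 <> 0%N.
Proof.
have [Gs Gi] := hG; move=> huniq g12 g23 g34 g13 g24 g14.
pose P (i : 'I_n) : R * R :=
  if i == v1 then (T 1 0 0, 0) else if i == v2 then (T 1 0 0, T 0 1 0) else
  if i == v3 then (T 0 0 1, T 0 1 0) else if i == v4 then (T 0 0 1, 0) else (0, 0).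
have [P1 [P2 [P3 P4]]] : P v1 = (T 1 0 0, 0) /\ P v2 = (T 1 0 0, T 0 1 0) /\
    P v3 = (T 0 0 1, T 0 1 0) /\ P v4 = (T 0 0 1, 0).
  move: huniq; rewrite /= !inE !negb_or !andbT => /and3P[/and3P[n12 n13 n14] /andP[n23 n24] n34].
  rewrite /P !eqxx ![v2 == _]eq_sym ![v3 == _]eq_sym ![v4 == _]eq_sym ?eqxx.
  by rewrite (negbTE n12) (negbTE n13) (negbTE n14) (negbTE n23) (negbTE n24) (negbTE n34).
have Pcase u : [\/ u = v1, u = v2, u = v3 | u = v4 \/ P u = (0, 0)].
  rewrite /P; case: eqP => [->|_]; first by constructor.
  case: eqP => [->|_]; first by constructor.
  case: eqP => [->|_]; first by constructor.
  by case: eqP => [->|_]; constructor; [left | right].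
have Phom u : (P u).1 \is 1.-homog /\ (P u).2 \is 1.-homog.
  by case: (Pcase u) => [->|->|->|[->| ->]]; rewrite ?P1 ?P2 ?P3 ?P4 /=; split;
    rewrite ?rpred0 //; apply: T_homog.
(* The dual socle of K[a,b,c]/(a^2, ac - b^2, c^2), the image of the path ideal. *)
pose lam := wcoef [:: (1%N, 1%N, 1%N, 1 : K); (0%N, 3%N, 0%N, 1)] : {linear R -> K | *%R}.
apply: (@betti36 K n (point_map P) lam _ G (v1, v2) (v2, v3) (v3, v4)) => //.
- by move=> z; rewrite /point_map; case: (split z) => i; case: (Phom i).
- by move=> e; rewrite !inE => /or3P[] /eqP->.
- move=> [u v] j /andP[_ /= guv]; rewrite section_gb /=.
  have gN x y : G x y -> ~~ G x y -> False by move=> ->.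
  case: (Pcase u) (Pcase v) guv => [->|->|->|[->| ->]] [->|->|->|[->| ->]];
    rewrite ?Gi // ?[G v2 v1]Gs ?[G v3 _]Gs ?[G v4 _]Gs ?(negbTE g13) ?(negbTE g24) ?(negbTE g14) // => _;
    rewrite ?P1 ?P2 ?P3 ?P4 /= ?mul0r ?mulr0 ?subrr ?mulr0 ?linear0 //;
    case: (XT j) => ->; by wcompute.
rewrite /det3 /wdet /wval /wimg /lin_coef /= !ptof_l !ptof_r P1 P2 P3 P4 /= !mcoeff0 !U3 !mcoeffX !mk_eq /=.
rewrite ?mpolyC0 ?mpolyC1.
wcompute; by rewrite ?oppr_eq0 oner_eq0.
Qed.

(** With the vertices sent to (a, b), (b, c), (a, b + c), the determinant is a^2 c - a b^2 + abc -
    b^3 up to sign, on which [lam] is a unit in every characteristic. *)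
Lemma triangle_witness v1 v2 v3 : G v1 v2 -> G v2 v3 -> G v1 v3 ->
  betti (parity_ideal (K := K) G) 3 6 <> 0%N.
Proof.
have [Gs Gi] := hG; move=> g12 g23 g13.
have n12 : v1 != v2 by apply: contraTneq g12 => ->; rewrite Gi.
have n23 : v2 != v3 by apply: contraTneq g23 => ->; rewrite Gi.
have n13 : v1 != v3 by apply: contraTneq g13 => ->; rewrite Gi.
pose P (i : 'I_n) : R * R :=
  if i == v1 then (T 1 0 0, T 0 1 0) else if i == v2 then (T 0 1 0, T 0 0 1) else
  if i == v3 then (T 1 0 0, T 0 1 0 + T 0 0 1) else (0, 0).
have [P1 [P2 P3]] : P v1 = (T 1 0 0, T 0 1 0) /\ P v2 = (T 0 1 0, T 0 0 1) /\
    P v3 = (T 1 0 0, T 0 1 0 + T 0 0 1).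
  rewrite /P !eqxx ![v2 == _]eq_sym ![v3 == _]eq_sym ?eqxx.
  by rewrite (negbTE n12) (negbTE n13) (negbTE n23).
have Pcase u : [\/ u = v1, u = v2, u = v3 | P u = (0, 0)].
  rewrite /P; case: eqP => [->|_]; first by constructor.
  case: eqP => [->|_]; first by constructor.
  by case: eqP => [->|_]; constructor.
have Phom u : (P u).1 \is 1.-homog /\ (P u).2 \is 1.-homog.
  by case: (Pcase u) => ->; rewrite ?P1 ?P2 ?P3 /=; split;
    rewrite ?rpred0 //; try apply: rpredD; apply: T_homog.
(* The dual socle of K[a,b,c]/(ab - bc, a^2 - b^2 - bc, ab - bc - c^2). *)
pose lam := wcoef [:: (3%N, 0%N, 0%N, 1 : K); (1%N, 2%N, 0%N, 1);
  (0%N, 2%N, 1%N, 1); (2%N, 0%N, 1%N, 1); (0%N, 3%N, 0%N, -1)] : {linear R -> K | *%R}.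
apply: (@betti36 K n (point_map P) lam _ G (v1, v2) (v1, v3) (v2, v3)) => //.
- by move=> z; rewrite /point_map; case: (split z) => i; case: (Phom i).
- by move=> e; rewrite !inE => /or3P[] /eqP->.
- move=> [u v] j /andP[_ /= guv]; rewrite section_gb /=.
  case: (Pcase u) (Pcase v) guv => [->|->|->| ->] [->|->|->| ->];
    rewrite ?Gi // => _;
    rewrite ?P1 ?P2 ?P3 /= ?mul0r ?mulr0 ?subrr ?mulr0 ?linear0 //;
    case: (XT j) => ->; by wcompute.
rewrite /det3 /wdet /wval /wimg /lin_coef /= !ptof_l !ptof_r P1 P2 P3 /= !mcoeffD !U3 !mcoeffX !mk_eq /=.
rewrite ?mulr0n ?mulr1n ?addr0 ?add0r ?mpolyC0 ?mpolyC1.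
wcompute; by rewrite ?oppr_eq0 oner_eq0.
Qed.

(** If both configurations are absent, the ends of a walk of length three are adjacent, so walks
    from r shorten to an edge when odd and to length 0 or 2 when even. Adjacency to the root of the
    component is then a proper 2-colouring. *)
Lemma nonbipartite_cases : ~ bipartite G ->
  (exists v1 v2 v3, [/\ G v1 v2, G v2 v3 & G v1 v3]) \/
  (exists v1 v2 v3 v4, uniq [:: v1; v2; v3; v4] /\
    [/\ G v1 v2, G v2 v3 & G v3 v4] /\ [/\ ~~ G v1 v3, ~~ G v2 v4 & ~~ G v1 v4]).
Proof.
have [Gs Gi] := hG; move=> hnb; apply: NNPP => hno; apply: hnb.
have notri a b d : G a b -> G b d -> G a d = false.
  by move=> ab bd; apply/negP => ad; apply: hno; left; exists a, b, d.
have walk3 a b x d : G a b -> G b x -> G x d -> G a d.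
  move=> ab bx xd; apply/negPn/negP => nad; apply: hno; right; exists a, b, x, d.
  have nab : a != b by apply: contraTneq ab => ->; rewrite Gi.
  have nbx : b != x by apply: contraTneq bx => ->; rewrite Gi.
  have nxd : x != d by apply: contraTneq xd => ->; rewrite Gi.
  have nax : a != x by apply: contraNneq nad => ->.
  have nbd : b != d by apply: contraNneq nad => <-.
  have nad' : a != d.
    by apply/eqP => e; have := notri a b x ab bx; rewrite e Gs xd.
  split; first by rewrite /= !inE !negb_or nab nax nad' nbx nbd nxd.
  by split; split; rewrite ?nad ?(notri a b x) ?(notri b x d).
have csym : connect_sym G by apply: sym_connect_sym.
have reach r p : path G r p ->
    if odd (size p) then (G r (last r p) : Prop) else (r = last r p) \/ exists2 s, G r s & G s (last r p).
  elim/last_ind: p => [_|p x IH] /=; first by left.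
  rewrite rcons_path size_rcons last_rcons /= => /andP[/IH + lx].
  case: (odd (size p)) => /= [h|[e|[s rs sl]]].
  - by right; exists (last r p).
  - by rewrite {1}e.
  - exact: walk3 rs sl lx.
exists (fun v => G (fingraph.root G v) v) => u v uv.
have ruv : fingraph.root G u = fingraph.root G v.
  by apply/eqP; rewrite root_connect //; apply: connect1.
rewrite ruv; set r := fingraph.root G v.
have kind z : fingraph.root G z = r -> G r z \/ (r = z \/ exists2 s, G r s & G s z).
  move=> ez; have : connect G r z by rewrite -ez csym connect_root.
  by case/connectP => p /reach + ->; case: ifP; auto.
case: (boolP (G r u)) => ru; case: (boolP (G r v)) => rv //.
  by have := notri r u v ru uv; rewrite rv.
case: (kind u ruv) => [h|[e|[s rs su]]]; first by rewrite h in ru.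
  by move: rv; rewrite e uv.
by move: rv; rewrite (walk3 r s u v).
Qed.

Lemma nonbipartite_betti36 : ~ bipartite G -> betti (parity_ideal (K := K) G) 3 6 <> 0%N.
Proof.
case/nonbipartite_cases => [[v1 [v2 [v3 [h1 h2 h3]]]]|[v1 [v2 [v3 [v4 [hu [[h1 h2 h3] [h4 h5 h6]]]]]]]].
  exact: triangle_witness h1 h2 h3.
exact: path_witness hu h1 h2 h3 h4 h5 h6.
Qed.

End Witness.

(** * Binomial edge ideals *)

Section Subst.
Variables (K : fieldType) (N : nat).
Notation S := {mpoly K[N]}.
Implicit Types (p q a g : S) (A : {set 'I_N}).

Lemma mpoly_alg_ind (P : S -> Prop) :
  (forall c, P c%:MP) -> (forall p q, P p -> P q -> P (p + q)) ->
  (forall p k, P p -> P (p * 'X_k)) -> forall p, P p.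
Proof.
move=> PC PD PX.
have PM c m : P (c *: 'X_[m]).
  elim: {m}_.+1 {-2}m (ltnSn (mdeg m)) => // k IH m hk.
  have [->|] := eqVneq m 0%MM; first by rewrite mpolyX0 -mul_mpolyC mulr1.
  rewrite -mdeg_eq0 mdegE sum_nat_eq0 negb_forall => /existsP[i] /=.
  rewrite -lep1mP => hi; rewrite -(submK hi) mpolyXD scalerAl; apply/PX/IH.
  by move: hk; rewrite -{1}(submK hi) mdegD mdeg1; lia.
elim/mpolyind => [|c m p _ _ hp]; last exact: PD.
by rewrite -mpolyC0.
Qed.

Definition kill A : S -> S := mmap (@mpolyC N K) (fun v => if v \in A then 0 else 'X_v).
HB.instance Definition _ A := GRing.RMorphism.on (kill A).

Lemma killX A v : kill A 'X_v = if v \in A then 0 else 'X_v.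
Proof. by rewrite /kill mmapX mmap1U. Qed.

Lemma killC A c : kill A c%:MP = c%:MP.
Proof. exact: mmapC. Qed.

(** Every term of [a - kill A a] contains a variable of [A]. *)
Lemma kill_diff A J a g : idealP J -> (forall v, v \in A -> J ('X_v * g)) -> J ((a - kill A a) * g).
Proof.
move=> hJ h; have [J0 JD JM] := hJ; elim/mpoly_alg_ind: a => [c|p q hp hq|p k hp].
- by rewrite killC subrr mul0r.
- by rewrite rmorphD /= opprD addrACA mulrDl; apply: JD.
rewrite rmorphM /= killX; case: ifP => hk.
  by rewrite mulr0 subr0 -mulrA; apply/JM/h.
by rewrite (_ : _ * g = 'X_k * ((p - kill A p) * g)); [apply: JM | ring].
Qed.

Definition varI A : S -> Prop := igen (fun g => exists2 v, v \in A & g = 'X_v).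

Lemma varIP A p : varI A p <-> kill A p = 0.
Proof.
have hJ := igen_ideal (fun g : S => exists2 v, v \in A & g = 'X_v); split.
  apply: (igen_sub (J := fun p => kill A p = 0)); first split.
  - exact: rmorph0.
  - by move=> q r; rewrite rmorphD /= => -> ->; rewrite addr0.
  - by move=> q r; rewrite rmorphM /= => ->; rewrite mulr0.
  by move=> g [v vA ->]; rewrite killX vA.
move=> h; have -> : p = (p - kill A p) * 1 by rewrite h subr0 mulr1.
apply: kill_diff => // v vA.
by rewrite mulr1; apply: igen_gen; exists v.
Qed.

(** Variables are added one at a time, with e = 1; a new variable is regular modulo the others, so
    the colon ideal is the ideal itself. *)
Lemma good_varI A : good (varI A).
Proof.
have [k] := ubnP #|A|; elim: k A => // k IH A hA.
have [->|/set0Pn[v vA]] := eqVneq A set0.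
  apply: good_zero; last exact: igen0.
  move=> p /varIP h; have -> : p = (p - kill set0 p) * 1 by rewrite h subr0 mulr1.
  apply: (@kill_diff set0 (eq^~ 0)) => [|v]; last by rewrite inE.
  by split=> // [q r -> ->|q r ->]; rewrite ?addr0 ?mulr0.
have good' : good (varI (A :\ v)) by apply: IH; move: hA; rewrite (cardsD1 v) vA; lia.
have hX : ('X_v : S) \is 1.-homog by apply: dhomogX1.
apply: (@good_step _ _ (varI (A :\ v)) 'X_v 1 _ (igen_ideal _) _ hX) => //.
- by apply: igen_homI => g [u _ ->]; exists 1%N; apply: dhomogX1.
- apply: eq_good good' => p; rewrite /colon !varIP rmorphM /= killX !inE eqxx /=.
  split=> [->|/eqP]; first by rewrite mul0r.
  by rewrite mulf_eq0 -[X in _ || X]msize_poly_eq0 msizeX orbF => /eqP.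
move=> p; apply: igen_add => g; split.
  move=> [u uA ->]; have [->|ne] := eqVneq u v; [by right | left].
  by exists u; rewrite // !inE ne.
by case=> [[u /setD1P[_ uA] ->]|->]; [exists u | exists v].
Qed.

End Subst.

(** * Binomial edge ideals with killed vertices *)

Section Binomial.
Variables (K : fieldType) (n : nat) (c : 'I_n -> bool).
Notation S := {mpoly K[n + n]}.
Implicit Types (H : rel 'I_n) (W : {set 'I_n}) (u v w i j : 'I_n).

(* Exchanging x and y on one colour class turns parity binomials into 2-minors. *)
Definition var i (b : bool) : 'I_(n + n) := if b (+) c i then rshift n i else lshift n i.
Definition vtx (z : 'I_(n + n)) : 'I_n := match split z with inl i => i | inr i => i end.
Definition vty (z : 'I_(n + n)) : bool := match split z with inl i => c i | inr i => ~~ c i end.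

Lemma split_l i : split (lshift n i) = inl i :> 'I_n + 'I_n.
Proof. exact: (unsplitK (inl i)). Qed.

Lemma split_r i : split (rshift n i) = inr i :> 'I_n + 'I_n.
Proof. exact: (unsplitK (inr i)). Qed.

Lemma vtx_var i b : vtx (var i b) = i.
Proof. by rewrite /var /vtx; case: ifP; rewrite ?split_l ?split_r. Qed.

Lemma vty_var i b : vty (var i b) = b.
Proof. by rewrite /var /vty; case: ifP; rewrite ?split_l ?split_r; case: b (c i) => [] []. Qed.

Lemma varK z : var (vtx z) (vty z) = z.
Proof.
by rewrite /var /vtx /vty -[RHS]splitK; case: (split z) => i /=; case: (c i).
Qed.

Definition X i : S := 'X_(var i false).
Definition Y i : S := 'X_(var i true).
Definition minor i j : S := X i * Y j - Y i * X j.

Lemma F_antisym i j : minor i j = - minor j i.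
Proof. by rewrite /minor; ring. Qed.

Lemma F_homog i j : minor i j \is 2.-homog.
Proof. by apply: rpredB; apply: (@dhomogM _ _ mdeg 1 _ 1); apply: dhomogX1. Qed.

(** The vertices of [W] are deleted from [H] and both their variables adjoined, as in the second
    component of Ohtani's decomposition. *)
Definition gens H W (g : S) : Prop :=
  (exists i b, i \in W /\ g = 'X_(var i b)) \/
  (exists p q, [/\ H p q, p \notin W, q \notin W & g = minor p q]).

Definition bei H W : S -> Prop := igen (gens H W).

Definition complete_at H u : rel 'I_n := fun p q => H p q || [&& p != q, H u p & H u q].

Definition sgraph H := ssrbool.symmetric H /\ ssrbool.irreflexive H.

Lemma sgraph_compl H u : sgraph H -> sgraph (complete_at H u).
Proof.
case=> hs hi; split=> [p q|p]; rewrite /complete_at.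
  by rewrite hs eq_sym [H u p && _]andbC.
by rewrite hi eqxx.
Qed.

Lemma complN H u q : sgraph H -> complete_at H u u q = H u q.
Proof. by case=> _ hi; rewrite /complete_at hi andbF orbF. Qed.

Lemma bei_ideal H W : idealP (bei H W).
Proof. exact: igen_ideal. Qed.

Lemma bei_var H W i b : i \in W -> bei H W 'X_(var i b).
Proof. by move=> h; apply: igen_gen; left; exists i, b. Qed.

Lemma bei_varM H W i b (a : S) : i \in W -> bei H W (a * 'X_(var i b)).
Proof. by move=> h; have [_ _ JM] := bei_ideal H W; apply/JM/bei_var. Qed.

Lemma bei_F H W p q : H p q -> p \notin W -> q \notin W -> bei H W (minor p q).
Proof. by move=> h1 h2 h3; apply: igen_gen; right; exists p, q. Qed.

Lemma bei_F_in H W p q : (p \in W) || (q \in W) -> bei H W (minor p q).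
Proof.
have hJ := bei_ideal H W; case/orP=> h; rewrite /minor /X /Y; apply: idealB => //;
  rewrite ?[_ * 'X_(var q _)]mulrC; do ?[exact: bei_varM]; rewrite mulrC; exact: bei_varM.
Qed.

(** For neighbours p and q of u, a Plücker relation expresses a variable at u times the minor of p
    and q through the minors of the edges up and uq. *)
Lemma complete_kill H W u p q b : sgraph H -> complete_at H u p q -> u \notin W -> p \notin W -> q \notin W ->
  bei H W ('X_(var u b) * minor p q).
Proof.
move=> hH; have hJ := bei_ideal H W; have [_ _ JM] := hJ.
case/orP=> [h|/and3P[_ hp hq]] uW pW qW; first by apply/JM/bei_F.
have -> : 'X_(var u b) * minor p q = 'X_(var p b) * minor u q - 'X_(var q b) * minor u p.
  by case: b; rewrite /minor /X /Y; ring.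
by apply: idealB => //; apply: JM; apply: bei_F.
Qed.

Definition star u : {set 'I_(n + n)} := [set z | vtx z == u].

Lemma kill_F u p q : kill (star u) (minor p q) = if (p == u) || (q == u) then 0 else minor p q.
Proof.
rewrite /minor /X /Y rmorphB !rmorphM /= !killX !inE !vtx_var.
by case: (p == u); case: (q == u); rewrite /= ?mulr0 ?mul0r ?subr0.
Qed.

(** A variable at u carries the added minors into the ideal of [H], by [complete_kill]; minors
    involving u itself come from edges of [H], because completion does not change the neighbours of
    u. *)
Lemma complete_diff H W u p : sgraph H -> u \notin W ->
  bei (complete_at H u) W p -> bei H W (p - kill (star u) p).
Proof.
move=> hH uW; have hJ := bei_ideal H W; have [J0 JD JM] := hJ.
elim=> [|a g q hg _ IH]; first by rewrite rmorph0 subrr.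
rewrite rmorphD /= opprD addrACA; apply: JD => //; rewrite rmorphM /=.
case: hg => [[i [b [iW ->]]]|[s [t [hst sW tW ->]]]].
  rewrite killX inE vtx_var (negbTE (_ : i != u)); last by apply: contraNneq uW => <-.
  by rewrite -mulrBl; apply: bei_varM.
rewrite kill_F; case: ifP => [/orP[] /eqP e|_].
- by rewrite mulr0 subr0; apply/JM/bei_F => //; move: hst; rewrite e complN.
- rewrite mulr0 subr0; apply/JM/bei_F => //; move: hst; rewrite e.
  have [hs _] := hH; have [hs' _] := sgraph_compl u hH.
  by rewrite hs' complN // hs.
rewrite -mulrBl; apply: kill_diff => // z; rewrite inE => /eqP zu.
by rewrite -(varK z) zu; apply: complete_kill.
Qed.

(** Together with [complete_diff] this splits an element p common to both components as (p - kill p)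
    + kill p, with both parts in the ideal of [H]. *)
Lemma bei_kill H W u p : bei H (u |: W) p -> bei H W (kill (star u) p).
Proof.
have [J0 JD JM] := bei_ideal H W.
apply: (igen_sub (J := fun p => bei H W (kill (star u) p))) => [|g]; first split.
- by rewrite rmorph0.
- by move=> q r hq hr; rewrite rmorphD /=; apply: JD.
- by move=> q r hr; rewrite rmorphM /=; apply: JM.
case=> [[i [b [+ ->]]]|[s [t [hst + + ->]]]].
  rewrite killX !inE vtx_var; case: eqVneq => //= _; exact: bei_var.
rewrite !inE !negb_or kill_F => /andP[su sW] /andP[tu tW].
by rewrite (negbTE su) (negbTE tu); apply: bei_F.
Qed.

(* Ohtani's decomposition of a binomial edge ideal at a vertex. *)
Lemma bei_cap H W u p : sgraph H -> u \notin W ->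
  bei (complete_at H u) W p -> bei H (u |: W) p -> bei H W p.
Proof.
move=> hH uW h1 h2; have [_ JD _] := bei_ideal H W.
by rewrite -[p](subrK (kill (star u) p)); apply: JD; [apply: complete_diff | apply: bei_kill].
Qed.

Lemma bei_compl H W u p : bei H W p -> bei (complete_at H u) W p.
Proof.
apply: igen_sub; first exact: bei_ideal.
move=> g [[i [b [iW ->]]]|[s [t [hst sW tW ->]]]]; first exact: bei_var.
by apply: bei_F => //; rewrite /complete_at hst.
Qed.

Lemma bei_sub H W W' p : W \subset W' -> bei H W p -> bei H W' p.
Proof.
move=> sW; apply: igen_sub; first exact: bei_ideal.
move=> g [[i [b [iW ->]]]|[s [t [hst _ _ ->]]]]; first by apply/bei_var/(subsetP sW).
have [h|] := boolP ((s \in W') || (t \in W')); first exact: bei_F_in.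
by rewrite negb_or => /andP[h1 h2]; apply: bei_F.
Qed.

Definition simplicial H W v := [forall p, forall q,
  [==> p \notin W, q \notin W, p != q, H v p, H v q => H p q]].

Lemma simpP H W v : reflect (forall p q, p \notin W -> q \notin W -> p != q -> H v p -> H v q -> H p q)
  (simplicial H W v).
Proof.
apply: (iffP forallP) => [h p q h1 h2 h3 h4 h5|h p].
  by move/forallP/(_ q): (h p); rewrite h1 h2 h3 h4 h5.
apply/forallP => q; apply/implyP => h1; apply/implyP => h2; apply/implyP => h3.
by apply/implyP => h4; apply/implyP => h5; apply: h.
Qed.

Lemma simplicial_compl H W u v : sgraph H -> u \notin W -> simplicial H W v -> simplicial (complete_at H u) W v.
Proof.
move=> hH uW /simpP h; have [hs hi] := hH; apply/simpP => p q pW qW pq.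
rewrite /complete_at => /orP[vp|/and3P[_ uv up]] /orP[vq|/and3P[_ uv' uq]].
- by rewrite h.
- have [->|pu] := eqVneq p u; first by rewrite uq.
  by rewrite pq uq andbT [H u p]hs (h p u) ?orbT // hs.
- have [->|qu] := eqVneq q u; first by rewrite hs up.
  by rewrite pq up /= (h u q) ?orbT 1?eq_sym // hs.
- by rewrite pq up uq orbT.
Qed.

Lemma simplicial_self H W u : sgraph H -> simplicial (complete_at H u) W u.
Proof.
move=> hH; apply/simpP => p q _ _ pq; rewrite !complN // => up uq.
by rewrite /complete_at pq up uq orbT.
Qed.

Lemma simpU H W W' v : W \subset W' -> simplicial H W v -> simplicial H W' v.
Proof.
move=> sW /simpP h; apply/simpP => p q pW qW; apply: h.
  by apply: contra pW; apply/subsetP.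
by apply: contra qW; apply/subsetP.
Qed.

(** * Disjoint unions of cliques and their toric ideal *)

Section Cliques.
Variables (H : rel 'I_n) (W : {set 'I_n}).
Hypotheses (hH : sgraph H) (hsimp : forall v, v \notin W -> simplicial H W v).

(** When all vertices off [W] are simplicial, equality or adjacency is an equivalence relation
    there, and [rep] selects one vertex of each clique. *)
Definition rep i : 'I_n := odflt i [pick j | (j \notin W) && ((j == i) || H i j)].

Lemma rep_eqP i j : i \notin W -> j \notin W -> rep i = rep j -> i != j -> H i j.
Proof.
move=> iW jW e ij; have [hs hi] := hH.
have R k : k \notin W -> (rep k \notin W) /\ ((rep k == k) || H k (rep k)).
  by move=> kW; rewrite /rep; case: pickP => [k' /andP[]|/(_ k)]; rewrite ?kW ?eqxx.
have [] := R i iW; have [] := R j jW; rewrite e; set t := rep j => tW.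
case: (eqVneq t j) => [-> _ _|tj /= jt _]; case: (eqVneq _ i) => [e'|ti] /=.
- by rewrite e' eqxx in ij.
- by [].
- by move=> _; rewrite hs -e'.
by move=> it; apply: (simpP _ _ _ (hsimp tW)) => //; rewrite hs.
Qed.

Lemma rep_adj i j : i \notin W -> j \notin W -> H i j -> rep i = rep j.
Proof.
move=> iW jW ij; have [hs hi] := hH.
have E : [pick k | (k \notin W) && ((k == i) || H i k)] =
         [pick k | (k \notin W) && ((k == j) || H j k)].
  apply: eq_pick => k; apply: andb_id2l => kW.
  apply/orP/orP => -[/eqP->|h].
  - by right; rewrite hs.
  - have [->|kj] := eqVneq k j; [by left | right].
    by apply: (simpP _ _ _ (hsimp iW)) => //; rewrite eq_sym.
  - by right.
  - have [->|ki] := eqVneq k i; [by left | right].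
    by apply: (simpP _ _ _ (hsimp jW)) => //; [rewrite eq_sym | rewrite hs].
rewrite /rep E; case: pickP => // /(_ j); by rewrite jW eqxx.
Qed.

(** Exponents of the monomial map x_i -> s_i, y_i -> s_i t_C, with C the clique of i. The left
    variables of the same ring serve as the s_i, the right ones as the t_C. *)
Definition mu1 (z : 'I_(n + n)) : 'X_{1..n + n} :=
  (U_(lshift n (vtx z)) + if vty z then U_(rshift n (rep (vtx z))) else 0)%MM.
Definition mu (m : 'X_{1..n + n}) : 'X_{1..n + n} := (\sum_z mu1 z *+ m z)%MM.

Lemma mu_nz m t : (mu m t != 0%N) = [exists z, (m z != 0%N) && (mu1 z t != 0%N)].
Proof.
rewrite /mu mnm_sumE sum_nat_eq0 negb_forall; apply: eq_existsb => z /=.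
by rewrite mulmnE muln_eq0 negb_or andbC.
Qed.

Lemma muD m1 m2 : mu (m1 + m2)%MM = (mu m1 + mu m2)%MM.
Proof.
apply/mnmP => t; rewrite mnmDE /mu !mnm_sumE -big_split /=.
by apply: eq_bigr => z _; rewrite !mulmnE mnmDE mulnDr.
Qed.

Lemma muU z : mu U_(z)%MM = mu1 z.
Proof.
apply/mnmP => t; rewrite /mu mnm_sumE (bigD1 z) //= mulmnE mnm1E eqxx muln1.
by rewrite big1 ?addn0 // => z' ne; rewrite mulmnE mnm1E eq_sym (negbTE ne) muln0.
Qed.

Lemma mu1_l z i : (mu1 z (lshift n i) != 0%N) = (vtx z == i).
Proof.
rewrite mnmDE mnm1E eq_lshift addn_eq0 negb_and eqb0 negbK.
by case: (vty z); rewrite ?mnm1E ?eq_rlshift ?mnm0E ?eqxx ?orbF.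
Qed.

Lemma mu1_r z k : (mu1 z (rshift n k) != 0%N) = vty z && (rep (vtx z) == k).
Proof.
rewrite mnmDE mnm1E eq_lrshift add0n.
by case: (vty z); rewrite ?mnm1E ?eq_rshift ?mnm0E //= eqb0 negbK.
Qed.

Lemma mu_l m i : (mu m (lshift n i) != 0%N) = [exists b, m (var i b) != 0%N].
Proof.
rewrite mu_nz; apply/existsP/existsP => -[z].
  by case/andP=> mz; rewrite mu1_l => /eqP <-; exists (vty z); rewrite varK.
by move=> h; exists (var i z); rewrite h mu1_l vtx_var eqxx.
Qed.

Lemma mu_r m k : (mu m (rshift n k) != 0%N) = [exists j, (rep j == k) && (m (var j true) != 0%N)].
Proof.
rewrite mu_nz; apply/existsP/existsP => -[z].
  case/andP=> mz; rewrite mu1_r => /andP[tz e]; exists (vtx z).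
  by rewrite e; move: mz; rewrite -{1}(varK z) tz.
by case/andP=> e h; exists (var z true); rewrite h mu1_r vty_var vtx_var.
Qed.

Definition clean (m : 'X_{1..n + n}) := forall z, vtx z \in W -> m z = 0%N.

(** A common variable can be cancelled, which lowers the degree. If instead one monomial contains
    x_i and the other y_i, the factor t_C forces some y_j with j in the clique of i into the first;
    unless j = i, exchanging x_i y_j for y_i x_j creates a common variable. *)
Lemma mono_congr m m' : clean m -> clean m' -> mu m = mu m' -> bei H W ('X_[m] - 'X_[m']).
Proof.
have hJ := bei_ideal H W; have [J0 JD JM] := hJ.
have [k] := ubnP (mdeg m + mdeg m')%N; elim: k m m' => // k IH m m' hk cm cm' e.
have share m1 m2 z : (mdeg m1 + mdeg m2 < k.+1)%N -> clean m1 -> clean m2 -> mu m1 = mu m2 ->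
    m1 z != 0%N -> m2 z != 0%N -> bei H W ('X_[m1] - 'X_[m2]).
  rewrite -!lep1mP => hk' c1 c2 e' h1 h2.
  rewrite -(submK h1) -(submK h2) !mpolyXD -mulrBl mulrC; apply: JM; apply: IH.
  - by move: hk'; rewrite -{1}(submK h1) -{1}(submK h2) !mdegD !mdeg1; lia.
  - by move=> z' hz'; rewrite mnmBE c1.
  - by move=> z' hz'; rewrite mnmBE c2.
  by move: e'; rewrite -{1}(submK h1) -{1}(submK h2) !muD; apply: addIm.
have caseA m1 m2 i : (mdeg m1 + mdeg m2 < k.+1)%N -> clean m1 -> clean m2 -> mu m1 = mu m2 ->
    m1 (var i false) != 0%N -> m2 (var i true) != 0%N -> bei H W ('X_[m1] - 'X_[m2]).
  move=> hk' c1 c2 e' h1 h2.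
  have iW : i \notin W by apply/negP => iW; rewrite c1 ?vtx_var in h1.
  have : mu m2 (rshift n (rep i)) != 0%N by rewrite mu_r; apply/existsP; exists i; rewrite eqxx h2.
  rewrite -e' mu_r => /existsP[j /andP[/eqP ji hj]].
  have [eij|ij] := eqVneq i j; first by apply: (share _ _ (var i true)) => //; rewrite eij.
  have jW : j \notin W by apply/negP => jW; rewrite c1 ?vtx_var in hj.
  have Hij : H i j by apply: rep_eqP.
  have nez : var i false != var j true.
    by apply/eqP => /(congr1 vtx); rewrite !vtx_var; apply/eqP.
  pose r := (m1 - U_(var i false) - U_(var j true))%MM.
  have em1 : m1 = (r + (U_(var i false) + U_(var j true)))%MM.
    apply/mnmP => z; rewrite /r !(mnmDE, mnmBE, mnm1E).
    have [ez|_] := eqVneq (var i false) z; have [ez'|_] := eqVneq (var j true) z.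
    - by move: nez; rewrite ez ez' eqxx.
    - by move: h1; rewrite ez; lia.
    - by move: hj; rewrite ez'; lia.
    - by rewrite /=; lia.
  pose m3 := (r + (U_(var i true) + U_(var j false)))%MM.
  have mu3 : mu m1 = mu m3.
    rewrite {1}em1 /m3 !muD !muU /mu1 !vtx_var !vty_var ji.
    by congr (_ + _)%MM; apply/mnmP => z; rewrite !(mnmDE, mnm0E); lia.
  have J3 : bei H W ('X_[m1] - 'X_[m3]).
    rewrite {1}em1 /m3 !mpolyXD -mulrBr; apply: JM.
    exact: bei_F.
  rewrite -['X_[m1]](subrK 'X_[m3]) -addrA; apply: JD => //.
  apply: (share _ _ (var i true)) => //.
  - by move: hk'; rewrite {1}em1 /m3 !mdegD !mdeg1.
  - move=> z zW; rewrite /m3 !(mnmDE, mnmBE, mnm1E) c1 // !sub0n.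
    have -> : (var i true == z) = false.
      by apply: contraNF iW => /eqP ez; rewrite -(vtx_var i true) ez.
    have -> : (var j false == z) = false => //.
    by apply: contraNF jW => /eqP ez; rewrite -(vtx_var j false) ez.
  - by rewrite -mu3.
  - by rewrite /m3 !(mnmDE, mnm1E) eqxx addnCA.
have [z hz|m0] := pickP (fun z => m z != 0%N); last first.
  have em : m = 0%MM by apply/mnmP => z; rewrite mnm0E; apply/eqP; rewrite -[_ == _]negbK m0.
  have em' : m' = 0%MM.
    apply/mnmP => z; rewrite mnm0E; apply/eqP; rewrite -[_ == _]negbK; apply/negP => hz.
    have : mu m' (lshift n (vtx z)) != 0%N.
      by rewrite mu_l; apply/existsP; exists (vty z); rewrite varK.
    by rewrite -e mu_l => /existsP[b]; rewrite m0.
  by rewrite em em' subrr.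
have : mu m (lshift n (vtx z)) != 0%N by rewrite mu_l; apply/existsP; exists (vty z); rewrite varK.
rewrite e mu_l => /existsP[b hb].
have [eb|nb] := eqVneq b (vty z); first by apply: (share _ _ z) => //; rewrite -(varK z) -eb.
case bE: (vty z) nb => nb; case: b hb nb => // hb _.
  rewrite -opprB; apply: idealN => //; apply: (caseA _ _ (vtx z)) => //; first by rewrite addnC.
  by rewrite -bE varK.
by apply: (caseA _ _ (vtx z)) => //; rewrite -bE varK.
Qed.

Definition phi_var (z : 'I_(n + n)) : S := if vtx z \in W then 0 else 'X_[mu1 z].
Definition phi : S -> S := mmap (@mpolyC (n + n) K) phi_var.
HB.instance Definition _ := GRing.RMorphism.on phi.

Lemma phiX z : phi 'X_z = phi_var z.
Proof. by rewrite /phi mmapX mmap1U. Qed.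

Lemma phi_clean (m : 'X_{1..n + n}) : clean m -> phi 'X_[m] = 'X_[mu m].
Proof.
move=> cm; rewrite /phi mmapX /mmap1 -mprodXnE; apply: eq_bigr => z _; rewrite /phi_var.
by case: ifP => // zW; rewrite cm // !expr0.
Qed.

Lemma phi_unclean (m : 'X_{1..n + n}) z : vtx z \in W -> m z != 0%N -> phi 'X_[m] = 0.
Proof.
move=> zW; rewrite -lep1mP => h; rewrite -(submK h) mpolyXD rmorphM /= phiX /phi_var zW.
by rewrite mulr0.
Qed.

Lemma phi_JJ p : bei H W p -> phi p = 0.
Proof.
apply: (igen_sub (J := fun p => phi p = 0)) => [|g]; first split.
- exact: rmorph0.
- by move=> q r; rewrite rmorphD /= => -> ->; rewrite addr0.
- by move=> q r; rewrite rmorphM /= => ->; rewrite mulr0.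
case=> [[i [b [iW ->]]]|[s [t [hst sW tW ->]]]]; first by rewrite phiX /phi_var vtx_var iW.
rewrite /minor /X /Y rmorphB !rmorphM /= !phiX /phi_var !vtx_var (negbTE sW) (negbTE tW).
rewrite -!mpolyXD /mu1 !vtx_var !vty_var (rep_adj sW tW hst).
set m1 := (_ + _)%MM; set m2 := (_ + _)%MM in |- *.
suff -> : m1 = m2 by rewrite subrr.
by apply/mnmP => z; rewrite /m1 /m2 !(mnmDE, mnm0E); lia.
Qed.

(* Cliques give a toric ideal: monomials with equal image under [phi] are congruent. *)
Lemma ker_phi p : phi p = 0 -> bei H W p.
Proof.
move=> hp; have hJ := bei_ideal H W; have [J0 JD JM] := hJ.
(* [g] selects a preimage of each monomial and [L] extends it linearly, truncated at a degree large
   enough for the image of p. Then p - L(phi p) is a sum of differences of congruent monomials and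
   of monomials with a variable from [W]. *)
pose g nu := epsilon (inhabits (0%MM : 'X_{1..n + n})) (fun m => clean m /\ mu m = nu).
have gP m : clean m -> clean (g (mu m)) /\ mu (g (mu m)) = mu m.
  by move=> cm; apply: (epsilon_spec (inhabits (0%MM : 'X_{1..n + n})) (fun m' => clean m' /\ mu m' = mu m)); exists m.
pose k := (\max_(m <- msupp p) mdeg (mu m)).+1.
pose L (q : S) : S := \sum_(nu : 'X_{1..(n + n)%N < k}) q@_nu *: 'X_[g nu].
have L0 : L 0 = 0 by rewrite /L big1 // => nu _; rewrite mcoeff0 scale0r.
have LD q r : L (q + r) = L q + L r.
  by rewrite /L -big_split; apply: eq_bigr => nu _; rewrite mcoeffD scalerDl.
have LZ a q : L (a *: q) = a *: L q.
  by rewrite /L scaler_sumr; apply: eq_bigr => nu _; rewrite mcoeffZ scalerA.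
have LX nu : (mdeg nu < k)%N -> L 'X_[nu] = 'X_[g nu].
  move=> h; rewrite /L (bigD1 (BMultinom h)) //= mcoeffX eqxx scale1r big1 ?addr0 // => nu' ne.
  by rewrite mcoeffX; case: eqP => [e|]; rewrite ?scale0r //; case/negP: ne; rewrite bmeqP -e.
have -> : p = p - L (phi p) by rewrite hp L0 subr0.
have -> : L (phi p) = \sum_(m <- msupp p) p@_m *: L (phi 'X_[m]).
  rewrite {1}(mpolyE p) raddf_sum /= (big_morph L LD L0); apply: eq_bigr => m _.
  by rewrite -mul_mpolyC rmorphM /= [phi _%:MP]mmapC mul_mpolyC LZ.
rewrite {1}(mpolyE p) -sumrB big_seq; apply: ideal_sum => // m hm.
rewrite -scalerBr; apply: idealZ => //.
have [cm|ncm] := classic (clean m).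
  rewrite phi_clean // LX; last by rewrite ltnS; apply: leq_bigmax_seq.
  by have [c1 e1] := gP m cm; apply: mono_congr.
have [z zW mz] : exists2 z, vtx z \in W & m z != 0%N.
  apply: NNPP => h; apply: ncm => z zW; apply/eqP; apply/negPn/negP => mz.
  by apply: h; exists z.
rewrite (phi_unclean zW mz) L0 subr0; move: mz; rewrite -lep1mP => h.
by rewrite -(submK h) mpolyXD -(varK z); apply: bei_varM.
Qed.

End Cliques.

(** [Q] is an invariant kept by both moves of Ohtani's decomposition. A move at a vertex that is not
    simplicial lowers the number of such vertices off [W]; when none is left, the ideal is the
    kernel of [phi], whose target is a domain. *)
Lemma nzd (Q : rel 'I_n -> {set 'I_n} -> Prop) (f : S) :
  (forall H W u, sgraph H -> Q H W -> u \notin W -> ~~ simplicial H W u ->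
     Q (complete_at H u) W /\ Q H (u |: W)) ->
  (forall H W, sgraph H -> Q H W -> phi H W f != 0) ->
  forall H W h, sgraph H -> Q H W -> bei H W (h * f) -> bei H W h.
Proof.
move=> Qstep Qf H W h.
have [k] := ubnP #|[set v | (v \notin W) && ~~ simplicial H W v]|.
elim: k H W => // k IH H W hk hH hQ hJ.
have [u /andP[uW su]|all] := pickP (fun v => (v \notin W) && ~~ simplicial H W v); last first.
  have hs v : v \notin W -> simplicial H W v by move=> vW; move: (all v); rewrite vW /= => /negbFE.
  apply: ker_phi => //; have := phi_JJ hH hs hJ; rewrite rmorphM /= => /eqP.
  by rewrite mulf_eq0 (negbTE (Qf H W hH hQ)) orbF => /eqP.
have [Q1 Q2] := Qstep H W u hH hQ uW su.
have hu : u \in [set v | (v \notin W) && ~~ simplicial H W v] by rewrite inE uW.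
move: hk; rewrite (cardsD1 u) hu add1n ltnS => hk.
apply: (bei_cap hH uW); apply: IH => //.
- apply: leq_ltn_trans hk; apply: subset_leq_card; apply/subsetP => v; rewrite !inE.
  case/andP=> vW sv; rewrite vW /=; apply/andP; split.
    by apply: contraNneq sv => ->; apply: simplicial_self.
  by apply: contra sv; apply: simplicial_compl.
- exact: sgraph_compl.
- exact: bei_compl.
- apply: leq_ltn_trans hk; apply: subset_leq_card; apply/subsetP => v; rewrite !inE negb_or.
  case/andP=> /andP[vu vW] sv; rewrite vW vu /=.
  by apply: contra sv; apply: simpU; apply: subsetUr.
- by apply: bei_sub hJ; apply: subsetUr.
Qed.

(** The decomposition is never made at a simplicial vertex, so u and the isolated w stay outside
    [W]. They end in different cliques, and the two products of the minor map to s_w s_u times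
    different variables t. *)
Lemma nzd_bridge H W u w h : sgraph H -> u \notin W -> w \notin W -> u != w ->
  simplicial H W u -> (forall j, ~~ H w j) -> bei H W (h * minor w u) -> bei H W h.
Proof.
move=> hH uW wW uw su iw.
pose Q H W := [/\ u \notin W, w \notin W, simplicial H W u & forall j, ~~ H w j].
apply: (@nzd Q) => // {h hH uW wW su iw H W} H W.
  move=> u' hH [uW wW su iw] u'W su'.
  have nu : u != u' by apply: contraNneq su' => <-.
  have nw : w != u'.
    by apply: contraNneq su' => <-; apply/simpP => p q _ _ _; rewrite (negbTE (iw p)).
  have [hs _] := hH; split; split=> //.
  - exact: simplicial_compl.
  - by move=> j; rewrite /complete_at (negbTE (iw j)) [H u' w]hs (negbTE (iw u')) andbF.
  - by rewrite !inE negb_or nu.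
  - by rewrite !inE negb_or nw.
  - by apply: simpU su; apply: subsetUr.
move=> hH [uW wW su iw].
have rw : rep H W w = w.
  rewrite /rep; case: pickP => //= j /andP[_]; rewrite (negbTE (iw j)) orbF => /eqP->//.
have ru : rep H W u != w.
  rewrite /rep; case: pickP => //= j /andP[_]; have [hs _] := hH.
  by case/orP => [/eqP->//|h]; apply: contraTneq h => ->; rewrite hs.
rewrite /minor /X /Y rmorphB !rmorphM /= !phiX /phi_var !vtx_var (negbTE uW) (negbTE wW).
rewrite -!mpolyXD /mu1 !vtx_var !vty_var rw subr_eq0.
apply: contra ru => /eqP e; have : ('X_[(U_(lshift n w) + 0 + (U_(lshift n u) + U_(rshift n (rep H W u))))%MM] : S)@_(U_(lshift n w) + 0 + (U_(lshift n u) + U_(rshift n (rep H W u))))%MM = 1.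
  by rewrite mcoeffX eqxx.
rewrite e mcoeffX; case: eqP => [/mnmP/(_ (rshift n (rep H W u)))|_ /eqP].
  rewrite !(mnmDE, mnm1E, mnm0E) !eq_lrshift !eq_rshift eqxx /=; case: eqP => [->//|//].
by rewrite eq_sym oner_eq0.
Qed.

(** The two products map to s_a s_b and to s_a s_b times two variables t, which differ whether or
    not a and b share a clique. *)
Lemma nzd_parity H W a b h : sgraph H -> a \notin W -> b \notin W ->
  simplicial H W a -> simplicial H W b -> bei H W (h * (X a * X b - Y a * Y b)) -> bei H W h.
Proof.
move=> hH aW bW sa sb.
pose Q H W := [/\ a \notin W, b \notin W, simplicial H W a & simplicial H W b].
apply: (@nzd Q) => // {h hH aW bW sa sb H W} H W.
  move=> u' hH [aW bW sa sb] u'W su'.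
  split; split=> //.
  - exact: simplicial_compl.
  - exact: simplicial_compl.
  - by rewrite !inE negb_or aW andbT; apply: contraNneq su' => <-.
  - by rewrite !inE negb_or bW andbT; apply: contraNneq su' => <-.
  - by apply: simpU sa; apply: subsetUr.
  - by apply: simpU sb; apply: subsetUr.
move=> hH [aW bW sa sb].
rewrite /X /Y rmorphB !rmorphM /= !phiX /phi_var !vtx_var (negbTE aW) (negbTE bW).
rewrite -!mpolyXD /mu1 !vtx_var !vty_var subr_eq0; apply/eqP.
set m1 := (_ + _)%MM; set m2 := (_ + _)%MM in |- * => e.
have := congr1 (fun p : S => p@_m2) e; rewrite !mcoeffX eqxx.
case: eqP => [/mnmP/(_ (rshift n (rep H W a)))|_ /eqP]; last by rewrite eq_sym oner_eq0.
by rewrite /m1 /m2 !(mnmDE, mnm1E, mnm0E) !eq_lrshift eqxx.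
Qed.

(** A perfect elimination order, the usual certificate of chordality, when [rho] is injective. *)
Definition elim_order (rho : 'I_n -> nat) H := forall w p q, p != q -> H w p -> H w q ->
  (rho p < rho w)%N -> (rho q < rho w)%N -> H p q.

(** The delicate case has p adjacent to w in [H] and q joined to w through u. If u precedes w, then
    p is u or adjacent to u, and the completion joins p and q. If u follows w, then w and q are
    preceding neighbours of u, so wq and hence pq was already an edge. *)
Lemma elim_order_compl rho H u : injective rho -> sgraph H -> elim_order rho H -> elim_order rho (complete_at H u).
Proof.
move=> inj hH hp w p q; have [hs hi] := hH.
suff key p' q' : p' != q' -> H w p' -> [&& w != q', H u w & H u q'] ->
    (rho p' < rho w)%N -> (rho q' < rho w)%N -> complete_at H u p' q'.
  move=> pq /orP[wp|wp] /orP[wq|wq] lp lq.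
  - by rewrite /complete_at (hp w).
  - exact: key.
  - by have [hs' _] := sgraph_compl u hH; rewrite hs'; apply: key => //; rewrite eq_sym.
  - by move: wp wq => /and3P[_ _ up] /and3P[_ _ uq]; rewrite /complete_at pq up uq orbT.
move=> pq wp /and3P[wq uw uq] lp lq; rewrite /complete_at pq uq andbT /=.
have [->|pu] := eqVneq p' u; first by rewrite uq.
case: (ltngtP (rho u) (rho w)) => [lt|gt|e].
- by rewrite [H u p']hs (hp w p' u) ?orbT // hs.
- by rewrite (hp w p' q') // (hp u w q') // (ltn_trans lq).
- by move: uw; rewrite (inj _ _ e) hi.
Qed.

Lemma homI_gens H W (s : seq 'I_n) w :
  homI (igen (fun g => gens H W g \/ exists2 u, u \in s & g = minor w u)).
Proof.
apply: igen_homI => g [[[i [b [_ ->]]]|[p [q [_ _ _ ->]]]]|[u _ ->]].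
- by exists 1%N; apply: dhomogX1.
- by exists 2%N; apply: F_homog.
- by exists 2%N; apply: F_homog.
Qed.

(** A variable at v in [s] enters the colon by z_v F(w,u) = z_w F(v,u) + z_u F(w,v), with F the
    minor, which requires the edge vu; the edges created by completion enter by [complete_kill].
    Conversely F(w,u) is regular modulo the right-hand side, where u has become simplicial and w is
    isolated. *)
Lemma colon_bridge H W (s : seq 'I_n) w u p : sgraph H -> (forall j, ~~ H w j) -> w \notin W ->
  u \notin W -> u != w -> u \notin s -> w \notin s ->
  (forall v, v \in s -> (v \notin W) && H v u) ->
  colon (igen (fun g => gens H W g \/ exists2 v, v \in s & g = minor w v)) (minor w u) p <->
  bei (complete_at H u) (W :|: [set v in s]) p.
Proof.
move=> hH iw wW uW uw us ws hs; set I := igen _; set W' := W :|: _.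
have hI : idealP I by apply: igen_ideal.
have [I0 ID IM] := hI.
have JI q : bei H W q -> I q.
  by apply: igen_sub => // g hg; apply: igen_gen; left.
have inW' v : v \in W' = (v \in W) || (v \in s) by rewrite !inE.
split=> [h|].
  apply: (@nzd_bridge (complete_at H u) W' u w).
  - exact: sgraph_compl.
  - by rewrite inW' negb_or uW.
  - by rewrite inW' negb_or wW.
  - by [].
  - exact: simplicial_self.
  - move=> j; rewrite /complete_at (negbTE (iw j)); have [-> _] := hH.
    by rewrite (negbTE (iw u)) andbF.
  move: h; rewrite /colon; apply: igen_sub; first exact: bei_ideal.
  move=> g [hg|[v vs ->]].
    by apply: (@bei_sub _ W); [apply: subsetUl | apply: bei_compl; apply: igen_gen].
  by apply: bei_F_in; rewrite [v \in _]inW' vs !orbT.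
apply: igen_sub; first exact: colon_ideal.
move=> g [[i [b [+ ->]]]|[x [y [hxy xW yW ->]]]].
  rewrite inW' => /orP[iW|is_]; first by rewrite /colon mulrC; apply: IM; apply/JI/bei_var.
  have /andP[iW iu] := hs i is_; rewrite /colon.
  have -> : 'X_(var i b) * minor w u = 'X_(var w b) * minor i u + 'X_(var u b) * minor w i.
    by case: b; rewrite /minor /X /Y; ring.
  apply: ID; first by apply/IM/JI/bei_F.
  by apply/IM/igen_gen; right; exists i.
move: xW yW; rewrite !inW' !negb_or => /andP[xW _] /andP[yW _]; rewrite /colon.
have -> : minor x y * minor w u = X w * (Y u * minor x y) - Y w * (X u * minor x y) by rewrite /minor; ring.
by apply: idealB => //; apply/IM/JI/complete_kill.
Qed.

(** The induction is on a bound for the ranks of vertices with edges: completion adds edges but no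
    new endpoints, so the colon ideals stay within reach. The edges of the last vertex w are put
    back one by one, and since its neighbours form a clique, those already used are adjacent to the
    next one, as [colon_bridge] requires. *)
Lemma good_chordal rho H W : injective rho -> sgraph H -> elim_order rho H -> good (bei H W).
Proof.
move=> inj.
suff main t : forall H W, sgraph H -> elim_order rho H -> (forall i j, H i j -> (rho i < t)%N) -> good (bei H W).
  move=> hH hp; apply: (main (\max_i rho i).+1) => // i j _.
  by rewrite ltnS; apply: leq_bigmax.
elim: t => [|t IH] {}H {}W hH hp ht.
  apply: eq_good (good_varI (A := [set z | vtx z \in W])) => p; split; apply: igen_sub;
    try exact: igen_ideal.
    by move=> g [z]; rewrite inE => zW ->; rewrite -(varK z); apply: bei_var.
  move=> g [[i [b [iW ->]]]|[x [y [/ht]]]]; last by rewrite ltn0.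
  by apply: igen_gen; exists (var i b) => //; rewrite inE vtx_var.
have [w /eqP wt|now] := pickP (fun w => rho w == t); last first.
  by apply: IH => // i j /ht; rewrite ltnS leq_eqVlt now.
pose H' : rel 'I_n := fun p q => [&& H p q, p != w & q != w].
have [hs hi] := hH.
have hH' : sgraph H' by split=> [p q|p]; rewrite /H' ?hi // hs; case: (p == w); case: (q == w).
have hp' : elim_order rho H'.
  move=> v p q pq /and3P[h1 _ pw] /and3P[h2 _ qw] l1 l2.
  by rewrite /H' pw qw (hp v).
have lt' i : i != w -> (rho i < t.+1)%N -> (rho i < t)%N.
  move=> iw; rewrite ltnS leq_eqVlt -wt; case: eqP => // /inj e; by rewrite e eqxx in iw.
have ht' i j : H' i j -> (rho i < t)%N by case/and3P=> /ht h iw _; apply: lt'.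
have iw j : ~~ H' w j by rewrite /H' eqxx andbF.
(* If w is already killed, its edges give no generators and [H'] defines the same ideal. *)
have [wW|wW] := boolP (w \in W).
  apply: eq_good (IH H' W hH' hp' ht') => p; split; apply: igen_sub; try exact: bei_ideal.
    move=> g [[i [b [iW ->]]]|[x [y [/and3P[h _ _] xW yW ->]]]]; first exact: bei_var.
    exact: bei_F.
  move=> g [[i [b [iW ->]]]|[x [y [h xW yW ->]]]]; first exact: bei_var.
  apply: bei_F => //; rewrite /H' h /=.
  by apply/andP; split; [apply: contraNneq xW => -> | apply: contraNneq yW => ->].
have main s : uniq s -> (forall u, u \in s -> (u \notin W) && H w u) ->
    good (igen (fun g => gens H' W g \/ exists2 u, u \in s & g = minor w u)).
  elim: s => [_ _|u s IHs /= /andP[us uniqs] hus].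
    apply: eq_good (IH H' W hH' hp' ht') => p; split; apply: igen_sub; try exact: igen_ideal.
      by move=> g hg; apply: igen_gen; left.
    by move=> g [hg|[u]]; [apply: igen_gen | rewrite in_nil].
  have gs := IHs uniqs (fun v vs => hus v (mem_behead (s := u :: s) vs)).
  have /andP[uW wu] := hus u (mem_head _ _).
  have nw v : H w v -> v != w by move=> h; apply: contraTneq h => ->; rewrite hi.
  have ltw v : H w v -> (rho v < rho w)%N.
    by move=> h; rewrite wt; apply: lt'; [apply: nw | apply: (ht v w); rewrite hs].
  have hus' v : v \in s -> (v \notin W) && H' v u.
    move=> vs; have /andP[vW wv] := hus v (mem_behead (s := u :: s) vs).
    rewrite vW /H' (nw v) // (nw u) // (hp w) ?ltw //.
    by apply: contraNneq us => <-.
  have ws : w \notin s.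
    by apply/negP => /hus'/andP[_]; rewrite (negbTE (iw u)).
  apply: (@good_step _ _ _ (minor w u) 2 _ (igen_ideal _) (@homI_gens H' W s w) (F_homog w u) _ gs).
  - by [].
  - apply: eq_good (IH (complete_at H' u) (W :|: [set v in s]) _ _ _) => [p||| i j].
    + by split=> h; apply/colon_bridge => //; rewrite ?nw //; apply/colon_bridge: h; rewrite ?nw.
    + exact: sgraph_compl.
    + exact: elim_order_compl.
    + case/orP; first exact: ht'.
      by case/and3P=> _; have [hs' _] := hH'; rewrite hs' => /ht'.
  move=> p; apply: igen_add => g; split.
    case=> [hg|[v]]; first by left; left.
    by rewrite inE => /orP[/eqP->|vs] ->; [right | left; right; exists v].
  case=> [[hg|[v vs ->]]|->]; first by left.
    by right; exists v; rewrite // inE vs orbT.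
  by right; exists u; rewrite // mem_head.
apply: eq_good (main [seq u <- enum 'I_n | (u \notin W) && H w u] _ _) => [p||u].
- split; apply: igen_sub; try exact: igen_ideal.
    move=> g [[[i [b [iW ->]]]|[x [y [/and3P[h _ _] xW yW ->]]]]|[u]]; first exact: bei_var.
      exact: bei_F.
    by rewrite mem_filter => /andP[/andP[uW wu] _] ->; apply: bei_F.
  move=> g [[i [b [iW ->]]]|[x [y [h xW yW ->]]]].
    by apply: igen_gen; left; left; exists i, b.
  have [ex|xw] := eqVneq x w.
    apply: igen_gen; right; exists y; rewrite ?ex // mem_filter yW -ex h.
    by rewrite mem_enum.
  have [ey|yw] := eqVneq y w.
    rewrite F_antisym; apply: idealN; first exact: igen_ideal.
    apply: igen_gen; right; exists x; rewrite ?ey // mem_filter xW -ey hs h.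
    by rewrite mem_enum.
  by apply: igen_gen; left; right; exists x, y; rewrite /H' h xw yw.
- by rewrite filter_uniq // enum_uniq.
- by rewrite mem_filter => /andP[].
Qed.

(** Each product in the quadric has a variable at b, which undoes the completion at b, and one at a,
    which then undoes the completion at a. Conversely both vertices are simplicial after the
    completions, so the quadric is regular there. *)
Lemma colon_parity H a b p : sgraph H ->
  colon (bei H set0) (X a * X b - Y a * Y b) p <-> bei (complete_at (complete_at H a) b) set0 p.
Proof.
move=> hH; have hH2 := sgraph_compl a hH.
have hJ := bei_ideal H set0; have [J0 JD JM] := hJ; split=> [h|].
  apply: (@nzd_parity _ _ a b).
  - exact: sgraph_compl.
  - by rewrite inE.
  - by rewrite inE.
  - by apply: simplicial_compl; rewrite ?inE //; apply: simplicial_self.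
  - exact: simplicial_self.
  - by apply/bei_compl/bei_compl.
have killa d q : bei (complete_at H a) set0 q -> bei H set0 ('X_(var a d) * q).
  rewrite mulrC; apply: (igen_sub (J := colon (bei H set0) 'X_(var a d))).
    exact: colon_ideal.
  move=> g [[i [d' [+ _]]]|[x [y [hxy _ _ ->]]]]; first by rewrite inE.
  by rewrite /colon mulrC; apply: complete_kill; rewrite ?inE.
apply: igen_sub; first exact: colon_ideal.
move=> g [[i [d' [+ _]]]|[x [y [hxy _ _ ->]]]]; first by rewrite inE.
rewrite /colon.
have -> : minor x y * (X a * X b - Y a * Y b) = X a * (X b * minor x y) - Y a * (Y b * minor x y) by ring.
by apply: idealB => //; apply: killa; apply: complete_kill; rewrite ?inE.
Qed.

Lemma good_parity rho H a b J : injective rho -> sgraph H -> elim_order rho H ->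
  (forall p, J p <-> exists u v : S, bei H set0 u /\ p = u + v * (X a * X b - Y a * Y b)) -> good J.
Proof.
move=> inj hH hp; apply: (@good_step _ _ _ _ 2) => //.
- exact: bei_ideal.
- apply: igen_homI => g [[i [d' [_ ->]]]|[x [y [_ _ _ ->]]]].
    by exists 1%N; apply: dhomogX1.
  by exists 2%N; apply: F_homog.
- by apply: rpredB; apply: (@dhomogM _ _ mdeg 1 _ 1); apply: dhomogX1.
- exact: good_chordal inj hH hp.
apply: eq_good (@good_chordal rho (complete_at (complete_at H a) b) set0 inj _ _).
- by move=> p; rewrite colon_parity.
- by do 2!apply: sgraph_compl.
- by do 2?[apply: elim_order_compl]; rewrite ?sgraph_compl //; apply: sgraph_compl.
Qed.

End Binomial.

(** * Odd unicyclic graphs *)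

Section Forest.
Variables (n : nat) (G : rel 'I_n).
Implicit Types (A : {set 'I_n}) (u v w x y : 'I_n).

(** Otherwise a path in A can be prolonged at its start by a neighbour other than its second vertex.
    Meeting the path again would close a cycle, so the path would grow beyond n vertices. *)
Lemma forest_leaf A : ssrbool.symmetric G -> ssrbool.irreflexive G ->
  (forall s, ~~ graph_cycle G s) -> A != set0 ->
  exists2 v, v \in A & forall p q, p \in A -> q \in A -> G v p -> G v q -> p = q.
Proof.
move=> Gs Gi acyc /set0Pn[x0 x0A]; apply: NNPP => hno.
have nbr v z : v \in A -> exists y, [/\ y \in A, G v y & y != z].
  move=> vA; apply: NNPP => h; apply: hno; exists v => // p q pA qA vp vq.
  have eqz y : y \in A -> G v y -> y = z.
    by move=> yA vy; apply/eqP/negPn/negP => yz; apply: h; exists y.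
  by rewrite (eqz p) // (eqz q).
have long k : exists x p, [/\ size p = k, path G x p, uniq (x :: p) & all (mem A) (x :: p)].
  elim: k => [|k [x [p [sp pp up ap]]]]; first by exists x0, [::]; rewrite /= x0A.
  have xA : x \in A by case/andP: ap.
  (* [head x p] is the neighbour of x already on the path; for a path with one vertex the default x
     excludes nothing, since G has no loops. *)
  have [y [yA xy yh]] := nbr x (head x p) xA.
  have yx : y != x by apply: contraTneq xy => ->; rewrite Gi.
  have [yp|yp] := boolP (y \in p); last first.
    by exists y, (x :: p); rewrite /= sp Gs xy pp inE negb_or yx yp yA -/(uniq (x :: p)) up; split.
  exfalso; case/splitPr: yp yh pp up => p1 p2 yh pp up.
  have := acyc (x :: rcons p1 y); rewrite /graph_cycle => /negP; apply.
  move: up; rewrite -cat_rcons -cat_cons cat_uniq => /andP[-> _] /=.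
  rewrite size_rcons; case: p1 yh pp => [|z p1] /=; first by rewrite eqxx.
  move=> _; rewrite -cat_rcons cat_path => /andP[xz /andP[pz _]].
  by rewrite xz rcons_path last_rcons pz Gs xy.
have [x [p [sp _ up _]]] := long n.
have := max_card (mem (x :: p)); rewrite (card_uniqP up) /= sp card_ord; lia.
Qed.

(** A leaf is removed, ranked last and coloured opposite to its only remaining neighbour. Every
    vertex then has at most one preceding neighbour, so the elimination condition holds
    vacuously. *)
Lemma forest_order : ssrbool.symmetric G -> ssrbool.irreflexive G ->
  (forall s, ~~ graph_cycle G s) ->
  exists (rho : 'I_n -> nat) (c : 'I_n -> bool), [/\ injective rho, elim_order rho G & forall u v, G u v -> c u != c v].
Proof.
move=> Gs Gi acyc.
suff main k A : #|A| = k -> exists (rho : 'I_n -> nat) (c : 'I_n -> bool),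
    [/\ {in A &, injective rho}, forall v, v \in A -> (rho v < k)%N,
     forall w p q, w \in A -> p \in A -> q \in A -> G w p -> G w q ->
       (rho p < rho w)%N -> (rho q < rho w)%N -> p = q &
     forall u v, u \in A -> v \in A -> G u v -> c u != c v].
  have [rho [c [inj _ hp hc]]] := main n [set: 'I_n] (etrans (cardsT _) (card_ord n)).
  exists rho, c; split=> [x y|w p q pq wp wq lp lq|u v uv].
  - by apply: inj; rewrite inE.
  - by case/negP: pq; apply/eqP; apply: (hp w) => //; rewrite inE.
  - by apply: hc; rewrite ?inE.
elim: k A => [|k IH] A hA.
  have A0 x : (x \in A) = false by move/eqP: hA; rewrite cards_eq0 => /eqP->; rewrite inE.
  by exists (fun=> 0%N), (fun=> false); split=> [x|x|w|u]; rewrite ?A0 // => ? ?; rewrite A0.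
have [|v vA leaf] := forest_leaf Gs Gi acyc (A := A); first by rewrite -card_gt0 hA.
have cA' : #|A :\ v| = k by move: hA; rewrite (cardsD1 v) vA => -[].
have [rho [c [inj lt hp hc]]] := IH _ cA'.
have inA' x : x \in A -> x != v -> x \in A :\ v by move=> h1 h2; rewrite !inE h2.
pose rho' x := if x == v then k else rho x.
pose cv := if [pick u in A | G v u] is Some u then ~~ c u else false.
pose c' x := if x == v then cv else c x.
have cvE u : u \in A -> G v u -> cv = ~~ c u.
  rewrite /cv => uA vu; case: pickP => [u' /andP[u'A vu']|/(_ u)]; last by rewrite uA vu.
  by rewrite (leaf u u').
exists rho', c'; rewrite /rho' /c'; split.
- move=> x y xA yA; case: (eqVneq x v) => [->|xv]; case: (eqVneq y v) => [->|yv] //.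
  + by move=> e; have := lt y (inA' y yA yv); rewrite -e ltnn.
  + by move=> e; have := lt x (inA' x xA xv); rewrite e ltnn.
  + by apply: inj; apply: inA'.
- by move=> x xA; case: eqVneq => // xv; apply: leqW; apply/lt/inA'.
- move=> w p q wA pA qA wp wq; case: (eqVneq w v) => [e|wv].
    by move=> _ _; apply: leaf => //; rewrite -e.
  have ltw := lt w (inA' w wA wv).
  case: (eqVneq p v) => [_|pv]; first by rewrite ltnNge (ltnW ltw).
  case: (eqVneq q v) => [_|qv]; first by rewrite [(k < _)%N]ltnNge (ltnW ltw).
  by apply: hp => //; apply: inA'.
move=> x y xA yA xy; case: (eqVneq x v) => [ex|xv]; case: (eqVneq y v) => [ey|yv].
- by move: xy; rewrite ex ey Gi.
- by rewrite (cvE y) -?ex //; case: (c y).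
- by rewrite (cvE x) // -?ey 1?Gs //; case: (c x).
- by apply: hc => //; apply: inA'.
Qed.

End Forest.

(** * Cutting the odd cycle *)

Section Unicyclic.
Variables (K : fieldType) (n : nat) (G : rel 'I_n).
Hypothesis hG : simple_graph G.

Lemma path_delete x b y q : x \notin y :: q -> path G y q -> path (delete_edge G x b) y q.
Proof.
elim: q y => //= z q IH y; rewrite !inE !negb_or => /and3P[xy xz xq] /andP[yz pz].
rewrite IH ?inE ?negb_or ?xz // andbT /delete_edge yz /=.
by apply/eqP => /setP/(_ x); rewrite !inE eqxx (negbTE xy) (negbTE xz).
Qed.

Lemma path_color (T : rel 'I_n) (c : 'I_n -> bool) x p : (forall u v, T u v -> c u != c v) ->
  path T x p -> c (last x p) = c x (+) odd (size p).
Proof.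
move=> hc; elim: p x => [|y p IH] x /=; first by rewrite addbF.
by case/andP=> /hc xy /IH ->; move: xy; case: (c x) (c y) (odd _) => [] [] [].
Qed.

(** The edge removed is the closing edge of the cycle: any cycle left would have the same edges,
    including the removed one. The rest of the odd cycle joins a to b by an even number of edges,
    whence their equal colours. *)
Lemma odd_unicyclic_edge : odd_unicyclic G -> exists a b (rho : 'I_n -> nat) (c : 'I_n -> bool),
  [/\ G a b, injective rho, elim_order rho (delete_edge G a b),
   forall u v, delete_edge G a b u v -> c u != c v & c a = c b].
Proof.
have [Gs Gi] := hG; case=> _ [s0 [cyc0 [odd0 uni]]].
have /and3P[uniq0 size0 cycle0] := cyc0.
case: s0 cyc0 odd0 uni uniq0 size0 cycle0 => // x [//|y q] cyc0 odd0 uni uniq0 size0 cycle0.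
pose s0 := [:: x, y & q]; pose b := last y q.
have := cycle0; rewrite /cycle rcons_path => /andP[pxy bx].
pose T := delete_edge G x b.
have Ts : ssrbool.symmetric T by move=> u v; rewrite /T /delete_edge Gs setUC.
have Ti : ssrbool.irreflexive T by move=> u; rewrite /T /delete_edge Gi.
have acyc s : ~~ graph_cycle T s.
  apply/negP => /and3P[us ss cs].
  have csG : cycle G s by apply: (sub_cycle (e := T)) cs => u v /andP[].
  (* The closing edge is read off at the last vertex b, where [next] wraps around to x. *)
  have : [set b; next s0 b] \in cycle_edges s.
    rewrite (uni s); last by rewrite /graph_cycle us ss csG.
    by apply: imset_f; rewrite /s0 inE mem_last orbT.
  have -> : next s0 b = x.
    have e := next_nth s0 b; rewrite e /s0 inE mem_last orbT.
    have ib : index b s0 = (size q).+1.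
      exact: (index_last uniq0).
    by rewrite -/s0 ib nth_default.
  case/imsetP => z zs e; have := next_cycle cs zs.
  by rewrite /T /delete_edge -e setUC eqxx andbF.
have [rho [c [inj hp hc]]] := forest_order Ts Ti acyc.
exists x, b, rho, c; split=> //; first by rewrite Gs.
have /andP[xy pyq] := pxy.
have /andP[xyq /andP[yq uq]] := uniq0.
have pT : path T x (y :: q).
  rewrite /= path_delete // andbT /T /delete_edge xy /=.
  apply/eqP => /setP/(_ y); rewrite !inE eqxx orbT.
  have -> : (y == x) = false by apply: contraNF xyq => /eqP->; rewrite mem_head.
  have -> // : (y == b) = false.
  apply: contraNF yq => /eqP e; rewrite {1}e /b; case: (q) size0 => // z q' _.
  exact: (mem_last z q').
have := path_color hc pT; rewrite /= -/b => ->.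
by move: odd0; rewrite /= negbK => ->; rewrite addbF.
Qed.

(** After the exchange, the minor of an edge of T is its parity binomial, with a sign that depends
    on which end has colour [true]. The ends of the cut edge have equal colours, so its binomial
    keeps the parity form up to sign. *)
Lemma odd_unicyclic_good : odd_unicyclic G -> good (parity_ideal (K := K) G).
Proof.
have [Gs Gi] := hG; case/odd_unicyclic_edge => a [b [rho [c [Gab inj hp hc cab]]]].
pose T := delete_edge G a b.
have hT : sgraph T.
  by split=> [u v|u]; rewrite /T /delete_edge ?Gi // Gs setUC.
have sign (p q : 'I_n) : T p q -> minor K c p q = gbar K p q \/ minor K c p q = - gbar K p q.
  move/hc; rewrite /minor /X /Y /var /gbar /xv /yv.
  by case: (c p); case: (c q) => // _ /=; [right | left]; ring.
pose f := X K c a * X K c b - Y K c a * Y K c b.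
have fsign : f = gbar K a b \/ f = - gbar K a b.
  rewrite /f /X /Y /var /gbar /xv /yv cab; case: (c b) => /=; [right | left]; ring.
have hI := parity_ideal_is_ideal K G; have [I0 ID IM] := hI.
apply: (good_parity (c := c) (a := a) (b := b) inj hT hp) => p; rewrite -/f.
rewrite -(igen_add (Q := fun g => gens (K := K) c T set0 g \/ g = f)); last by split.
have hQ := igen_ideal (fun g => gens (K := K) c T set0 g \/ g = f).
split.
  move/parityP => [r ->]; apply: ideal_sum => // e /andP[_ Ge].
  have [_ _ QM] := hQ; apply: QM.
  have [Te|nTe] := boolP (T e.1 e.2).
    have hF : igen (fun g => gens (K := K) c T set0 g \/ g = f) (minor K c e.1 e.2).
      by apply: igen_gen; left; right; exists e.1, e.2; rewrite !inE.
    rewrite /gb; have [<-//|e1] := sign _ _ Te.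
    by rewrite -[gbar K _ _]opprK -e1; apply: idealN.
  have hf : igen (fun g => gens (K := K) c T set0 g \/ g = f) f by apply: igen_gen; right.
  have hab : igen (fun g => gens (K := K) c T set0 g \/ g = f) (gbar K a b).
    have [<-//|e1] := fsign.
    by rewrite -[gbar K a b]opprK -e1; apply: idealN.
  move: nTe; rewrite /T /delete_edge Ge /= negbK => /eqP es.
  have ne : e.1 != e.2 by apply: contraTneq Ge => ->; rewrite Gi.
  have : e.1 \in [set a; b] by rewrite -es !inE eqxx.
  have : e.2 \in [set a; b] by rewrite -es !inE eqxx orbT.
  rewrite !inE /gb => /orP[] /eqP e2 /orP[] /eqP e1; rewrite e1 e2 // ?eqxx // in ne *.
  by rewrite gbarC.
apply: igen_sub => // g [[[i [d [+ _]]]|[p1 [q1 [T1 _ _ ->]]]]|->]; first by rewrite inE.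
  have Gpq : G p1 q1 by case/andP: T1.
  have hpq := parity_gbar K hG Gpq.
  by have [->|->] := sign _ _ T1 => //; apply: idealN.
have hab := parity_gbar K hG Gab.
by have [->|->] := fsign => //; apply: idealN.
Qed.

End Unicyclic.

Local Close Scope ring_scope.

Theorem theorem3p10 (K : fieldType) (n : nat) (G : rel 'I_n)
    (HG : simple_graph G) :
  (betti (parity_ideal (K:=K) G) 2 3 = 0 /\
   forall i, i <> 1 -> betti (parity_ideal (K:=K) G) i i.+1 = 0) /\
  (~ is_K2 G -> 'C(nedges G, 2) <= betti (parity_ideal (K:=K) G) 2 4) /\
  (forall a b, G a b -> forall i, 0 < i ->
     betti (colon (parity_ideal (K:=K) (delete_edge G a b)) (gbar K a b)) i i = 0) /\
  (~ bipartite G -> betti (parity_ideal (K:=K) G) 3 6 <> 0) /\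
  (odd_unicyclic G -> forall i j, 2 * i < j -> betti (parity_ideal (K:=K) G) i j = 0).
Proof.
have hI := parity_ideal_is_ideal K G.
split; first by split=> [|i]; apply: linear_strand.
split; first by move=> _; apply: koszul_syzygies.
split; first by move=> a b Gab i; apply: colon_diag.
split; first by move=> hnb; apply: nonbipartite_betti36.
move=> /(odd_unicyclic_good (K := K) HG) gG i j ij.
(* Here d = j - i - 1, and 2i < j becomes i <= d. *)
have -> : j = i + (j - i.+1).+1 by lia.
by apply: tor_vanish_betti => //; apply: gG; lia.
Qed.
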